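(* Let $\alpha>1$. The solution to the fractional Cauchy problem $$\frac{\partial u}{\partial t}(x,t)={}_{x}D^{\alpha}_{1}u(x,t),\qquad u(x,0)=\delta(x),$$ where ${}_{x}D^{\alpha}_{1}$ is the Riesz-Feller operator of order $\alpha$ and parameter $\theta=1$, is $$u_{\alpha}(x,t)=\frac{1}{(\alpha t)^{\frac{1}{\alpha}}}\,\mathrm{Ai}_{\alpha}\left(\frac{x}{(\alpha t)^{\frac{1}{\alpha}}}\right),\qquad x\in\mathbb{R},\ t>0,$$ where $\mathrm{Ai}_{\alpha}(x)=\frac{1}{\pi}\int_0^{+\infty}\cos\left(xs+\frac{s^{\alpha}}{\alpha}\right)ds$ (a convergent improper integral).
   Context: With $\mathcal{F}\{f\}(\gamma)=\int_{-\infty}^{+\infty}e^{i\gamma x}f(x)\,dx$, the Riesz-Feller operator ${}_xD^{\alpha}_{\theta}$ is defined implicitly by $\mathcal{F}\{{}_{x}D^{\alpha}_{\theta}f\}(\gamma)=-|\gamma|^{\alpha}e^{\frac{i\pi\theta}{2}\operatorname{sgn}(\gamma)}\mathcal{F}\{f\}(\gamma)$; for $\theta=1$ the multiplier is $-i\operatorname{sgn}(\gamma)|\gamma|^{\alpha}$. The solution of the Cauchy problem is understood via the Fourier transform in $x$ (in the sense of tempered distributions): it is the function $u(x,t)$ whose transform $\hat u(\gamma,t)$ satisfies $\partial_t\hat u(\gamma,t)=-i\operatorname{sgn}(\gamma)|\gamma|^{\alpha}\hat u(\gamma,t)$ for $t>0$ and $\hat u(\gamma,0)=1$, i.e. $\hat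 u(\gamma,t)=e^{-it\operatorname{sgn}(\gamma)|\gamma|^{\alpha}}$. *)

(* Defs.v *)
(* MathComp-Analysis, over an abstract realType R; complex values in R[i]. *)
From HB Require Import structures.
From mathcomp Require Import all_boot all_order all_algebra.
From mathcomp Require Import complex.
From mathcomp Require Import all_classical all_reals all_analysis.
Set Implicit Arguments.
Unset Strict Implicit.
Unset Printing Implicit Defensive.
Import Order.TTheory GRing.Theory Num.Theory.
Import numFieldNormedType.Exports.
Local Open Scope classical_set_scope.
Local Open Scope ring_scope.
Local Open Scope complex_scope.

Definition cmod (R : realType) (z : R[i]) : R := ComplexField.Normc.normc z.

(* exp (i y) *)
Definition expi (R : realType) (y : R) : R[i] := cos y +i* sin y.

(* R[i] carries no normed R-module structure in the libraries, so complex-valued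
   functions of a real variable are differentiated and integrated through their
   real and imaginary parts. *)
Definition cderive1n (R : realType) (n : nat) (f : R -> R[i]) (x : R) : R[i] :=
  derive1n n (fun y => complex.Re (f y)) x
    +i* derive1n n (fun y => complex.Im (f y)) x.

Definition is_cderive (R : realType) (f : R -> R[i]) (t : R) (d : R[i]) : Prop :=
  is_derive t 1 (fun s => complex.Re (f s)) (complex.Re d) /\
  is_derive t 1 (fun s => complex.Im (f s)) (complex.Im d).

Definition cintegrable (R : realType) (f : R -> R[i]) : Prop :=
  (@lebesgue_measure R).-integrable setT (EFin \o (fun x => complex.Re (f x))) /\
  (@lebesgue_measure R).-integrable setT (EFin \o (fun x => complex.Im (f x))).

Definition cintegral (R : realType) (f : R -> R[i]) : R[i] :=
  (\int[@lebesgue_measure R]_(x in setT) complex.Re (f x))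
    +i* (\int[@lebesgue_measure R]_(x in setT) complex.Im (f x)).

Definition schwartz (R : realType) (phi : R -> R[i]) : Prop :=
  (forall (n : nat) (x : R),
      derivable (derive1n n (fun y => complex.Re (phi y))) x 1 /\
      derivable (derive1n n (fun y => complex.Im (phi y))) x 1) /\
  (forall m n : nat, exists C : R, forall x : R,
      `|x| ^+ m * cmod (cderive1n n phi x) <= C).

Definition schwartz_seminorm (R : realType) (m n : nat) (phi : R -> R[i]) : R :=
  sup [set `|x| ^+ m * cmod (cderive1n n phi x) | x in setT].

(* A distribution is a functional on all functions R -> R[i], of which only the
   values on Schwartz functions matter. *)
Definition distr (R : realType) : Type := (R -> R[i]) -> R[i].

Definition tempered (R : realType) (T : distr R) : Prop :=
  (forall (a : R[i]) (phi psi : R -> R[i]), schwartz phi -> schwartz psi ->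
      T (fun x => a * phi x + psi x) = a * T phi + T psi) /\
  (exists (N : nat) (C : R), forall phi : R -> R[i], schwartz phi ->
      cmod (T phi) <=
        C * \sum_(m < N.+1) \sum_(n < N.+1) schwartz_seminorm m n phi).

(* T is the regular distribution given by the function f. *)
Definition represents (R : realType) (T : distr R) (f : R -> R[i]) : Prop :=
  forall phi : R -> R[i], schwartz phi ->
    cintegrable (fun x => f x * phi x) /\
    T phi = cintegral (fun x => f x * phi x).

Definition dirac_distr (R : realType) : distr R := fun phi => phi 0.

Definition eq_distr (R : realType) (S T : distr R) : Prop :=
  forall phi : R -> R[i], schwartz phi -> S phi = T phi.

Definition fourier (R : realType) (f : R -> R[i]) (gamma : R) : R[i] :=
  cintegral (fun x => expi (gamma * x) * f x).

Definition dfourier (R : realType) (T : distr R) : distr R :=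
  fun phi => T (fourier phi).

(* The Riesz-Feller operator of order alpha and parameter theta, on the Fourier
   side: it maps F{f} to F{D f}. *)
Definition riesz_feller_hat (R : realType) (alpha theta : R)
    (fhat : R -> R[i]) (gamma : R) : R[i] :=
  - (`|gamma| `^ alpha)%:C * expi (pi * theta / 2 * Num.sg gamma) * fhat gamma.

(* u solves d/dt u = D u, u(., 0) = delta, where D is the Riesz-Feller operator:
   u t is a tempered distribution for every t >= 0, whose Fourier transform is a
   function uhat(., t) that solves the transformed problem for each frequency.
   Continuity at t = 0 is what ties the equation on t > 0 to the initial value. *)
Definition riesz_feller_cauchy_solution (R : realType) (alpha theta : R)
    (u : R -> distr R) : Prop :=
  (forall t : R, 0 <= t -> tempered (u t)) /\
  eq_distr (u 0) (@dirac_distr R) /\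
  exists uhat : R -> R -> R[i],
    (forall t : R, 0 <= t ->
        represents (dfourier (u t)) (fun gamma => uhat gamma t)) /\
    (forall gamma t : R, 0 < t ->
        is_cderive (uhat gamma) t
          (riesz_feller_hat alpha theta (fun eta => uhat eta t) gamma)) /\
    (forall gamma : R, uhat gamma 0 = 1) /\
    (forall gamma : R, cmod (uhat gamma t - uhat gamma 0) @[t --> 0^'+] --> (0 : R)).

Definition airy_partial (R : realType) (alpha x A : R) : R :=
  \int[@lebesgue_measure R]_(s in `[0, A]) cos (x * s + s `^ alpha / alpha).

Definition airy (R : realType) (alpha x : R) : R :=
  pi^-1 * lim (airy_partial alpha x A @[A --> +oo]).

Definition u_airy (R : realType) (alpha x t : R) : R :=
  ((alpha * t) `^ alpha^-1)^-1 * airy alpha (x / (alpha * t) `^ alpha^-1).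

(* Main.v *)
(* Let T_b f (y) be the integral of cos (y x + b) f(x): T_0 and T_(-pi/2) are the
   cosine and sine transforms, out of which the complex Fourier transform F is
   built. T_b exchanges multiplication by x and differentiation, hence maps real
   Schwartz functions to Schwartz functions; inserting the weight exp (- e |x|),
   whose transform is the Poisson kernel, and letting e tend to 0 gives the
   inversion formula
     T_a (T_b f) (y) = pi (cos (a + b) f(- y) + cos (a - b) f(y)),
   so that F is onto the Schwartz functions.
   By the first derivative test the truncated Airy integrals converge and are
   bounded, uniformly in the truncation, by a polynomial in x. Fubini, inversion
   and dominated convergence then show that pairing u_airy with F phi is the
   same as integrating exp (- i t sgn(y) |y|^alpha) phi(y); this multiplier is the
   only solution of the transformed equation that is continuous at t = 0. *)
Require Import Defs.
From HB Require Import structures.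
From mathcomp Require Import all_boot all_order all_algebra.
From mathcomp Require Import complex.
From mathcomp Require Import all_classical all_reals all_analysis.
From mathcomp Require Import measurable_realfun ring lra.
Set Implicit Arguments.
Unset Strict Implicit.
Unset Printing Implicit Defensive.
Import Order.TTheory GRing.Theory Num.Theory.
Import numFieldNormedType.Exports.
Local Open Scope classical_set_scope.
Local Open Scope ring_scope.
Local Open Scope complex_scope.

(** The Airy integral is not absolutely convergent, so every exchange of integrals happens on
    truncations, and the limit needs a bound that Schwartz decay can absorb. For negative [x] the
    phase derivative [x + t alpha s^(alpha - 1)] vanishes at a point of order [|x|^(1/(alpha - 1))];
    up to that range only the length of the interval is used as a bound, whence the polynomial
    growth, and [alpha > 1] makes the derivative large afterwards. Inversion meets the same
    obstacle: [cos (y x + a) cos (x t + b) f(t)] is not integrable in [x], and the exponential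
    weight makes Fubini applicable. Arbitrary shifts are needed because, at a fixed [s], integrating
    the Airy phase against [T_b f] gives [T_a (T_b f) (s)] with [a = t |s|^alpha]. The two terms of
    the inversion formula are then the values at [s] and [- s] of one function, which unfolds the
    half line into the line. Surjectivity of F is essential: the Cauchy problem prescribes [u t]
    only on transforms [F phi], whereas the conclusion tests it on arbitrary Schwartz functions. *)

Notation L1 f := ((@lebesgue_measure _).-integrable setT (EFin \o f)).
Notation rint f := (Rintegral (@lebesgue_measure _) setT f).

(** * Lebesgue integrals of real functions over the line *)

Section integration_on_the_line.
Context {R : realType}.
Notation mu := (@lebesgue_measure R).
Implicit Types f g h k : R -> R.

Lemma L1_measurable f : L1 f -> measurable_fun setT f.
Proof. by move=> /integrableP[/measurable_EFinP]. Qed.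

Lemma L1_le f g : measurable_fun setT f -> L1 g ->
  (forall x, `|f x| <= g x) -> L1 f.
Proof.
move=> mf ig fg; apply: (le_integrable measurableT _ _ ig).
  exact/measurable_EFinP.
move=> x _ /=; rewrite lee_fin; apply: le_trans (fg x) _; exact: ler_norm.
Qed.

Lemma L1_norm f : L1 f -> L1 (fun x => `|f x|).
Proof. by move=> /(@integrable_abse _ _ _ mu setT _). Qed.

Lemma L1D f g : L1 f -> L1 g -> L1 (fun x => f x + g x).
Proof. by move=> intf intg; exact: (integrableD measurableT intf intg). Qed.

Lemma L1B f g : L1 f -> L1 g -> L1 (fun x => f x - g x).
Proof. by move=> intf intg; exact: (integrableB measurableT intf intg). Qed.

Lemma L1Z c f : L1 f -> L1 (fun x => c * f x).
Proof. by move=> intf; exact: (integrableZl measurableT c intf). Qed.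

Lemma L1_mul_bounded (c : R) k f : measurable_fun setT k -> (forall x, `|k x| <= c) ->
  L1 f -> L1 (fun x => k x * f x).
Proof.
move=> mk kc intf; apply: (@L1_le _ (fun x => c * `|f x|)).
- by apply: measurable_funM => //; exact: L1_measurable.
- exact/L1Z/L1_norm.
- by move=> x; rewrite normrM ler_wpM2r.
Qed.

Lemma rint_ext f g : f =1 g -> rint f = rint g.
Proof. by move=> fg; apply: eq_Rintegral => x _; exact: fg. Qed.

Lemma rintD f g : L1 f -> L1 g -> rint (fun x => f x + g x) = rint f + rint g.
Proof. exact: RintegralD. Qed.

Lemma rintB f g : L1 f -> L1 g -> rint (fun x => f x - g x) = rint f - rint g.
Proof. exact: RintegralB. Qed.

Lemma rintZ c f : L1 f -> rint (fun x => c * f x) = c * rint f.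
Proof. exact: RintegralZl. Qed.

Lemma le_norm_rint f g : L1 f -> L1 g -> (forall x, `|f x| <= g x) ->
  `|rint f| <= rint g.
Proof.
move=> intf intg fg; apply: le_trans (le_normr_Rintegral measurableT intf) _.
by apply: le_Rintegral => //; exact: L1_norm.
Qed.

Lemma rint_dominated_cvg (f_ : (R -> R)^nat) f g :
  (forall n, measurable_fun setT (f_ n)) ->
  (forall x, f_ n x @[n --> \oo] --> f x) -> L1 g ->
  (forall n x, `|f_ n x| <= g x) ->
  L1 f /\ rint (f_ n) @[n --> \oo] --> rint f.
Proof.
move=> mf_ ff ig fg.
have mf : measurable_fun setT f by apply: measurable_fun_cvg => // x _; exact: ff.
have Eff x : setT x -> (f_ n x)%:E @[n --> \oo] --> (f x)%:E.
  by move=> _; apply: cvg_EFin; [exact: nearW|exact: ff].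
have mEf_ n : measurable_fun setT (EFin \o f_ n) by exact/measurable_EFinP.
have mEf : measurable_fun setT (EFin \o f) by exact/measurable_EFinP.
have [] := @dominated_convergence _ _ _ mu setT measurableT
  (fun n => EFin \o f_ n) (EFin \o f) (EFin \o g).
- exact: mEf_.
- exact: mEf.
- by apply: aeW; exact: Eff.
- exact: ig.
- by apply: aeW => x n _ /=; rewrite lee_fin.
move=> intf _ cf.
split => //; apply: fine_cvg.
by rewrite fineK //; exact: integrable_fin_num.
Qed.

(** Since [|k| <= 1], the inner integral of the absolute value is at most [|g x|] times the norm of
    [h], so Tonelli gives integrability on the plane. This shape covers both kernels met later: a
    product of two cosines and the cosine of the Airy phase. *)
Lemma rint_fubini g h (k : R -> R -> R) : L1 g -> L1 h ->
  measurable_fun setT (fun z : R * R => k z.1 z.2) ->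
  (forall x y, `|k x y| <= 1) ->
  rint (fun x => g x * rint (fun y => h y * k x y)) =
  rint (fun y => h y * rint (fun x => g x * k x y)).
Proof.
move=> ig ih mk k1.
have mg := L1_measurable ig; have mh := L1_measurable ih.
pose f (z : R * R) : \bar R := (g z.1 * (h z.2 * k z.1 z.2))%:E.
have mf : measurable_fun setT f.
  apply/measurable_EFinP; apply: measurable_funM.
    exact: (measurableT_comp mg measurable_fst).
  by apply: measurable_funM => //; exact: (measurableT_comp mh measurable_snd).
have mkx x : measurable_fun setT (k x).
  exact: (measurableT_comp mk (pair1_measurable x)).
have mky y : measurable_fun setT (k ^~ y).
  exact: (measurableT_comp mk (pair2_measurable y)).
have ihk x : L1 (fun y => h y * k x y).
  under [X in _.-integrable _ (_ \o X)]eq_fun do rewrite mulrC.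
  exact: (L1_mul_bounded (mkx x) (k1 x)).
have igk y : L1 (fun x => g x * k x y).
  under [X in _.-integrable _ (_ \o X)]eq_fun do rewrite mulrC.
  exact: (L1_mul_bounded (mky y) (k1 ^~ y)).
have intf : (mu \x mu)%E.-integrable setT f.
  apply: (integrable12ltyP mu mu mf).2.
  apply: (@le_lt_trans _ _ (\int[mu]_x ((rint (fun y => `|h y|))%:E * `|g x|%:E))%E).
    apply: ge0_le_integral => //.
    - by move=> x _; apply: integral_ge0.
    - have mf' : measurable_fun setT (fun z => `|f z|%E) by exact: measurableT_comp.
      by apply: (@measurable_fun_fubini_tonelli_F _ _ _ _ R mu (fun z => `|f z|%E)).
    - by apply: measurable_funeM; apply/measurable_EFinP/measurableT_comp.
    - move=> x _; rewrite -EFinM mulrC EFinM.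
      rewrite /Rintegral fineK; last first.
        by apply: integrable_fin_num => //; exact: (L1_norm ih).
      rewrite -ge0_integralZl//.
      + apply: ge0_le_integral => //.
        * by apply: measurableT_comp => //; exact: (measurableT_comp mf (pair1_measurable x)).
        * by apply: measurable_funeM; apply/measurable_EFinP/measurableT_comp.
        * move=> y _; rewrite /f /= lee_fin !normrM ler_wpM2l//.
          by rewrite ler_piMr.
      + by apply/measurable_EFinP/measurableT_comp.
  rewrite integralZl //; last exact: (L1_norm ig).
  rewrite ltey_eq fin_numM//.
  by apply: integrable_fin_num => //; exact: (L1_norm ig).
have := Fubini intf.
rewrite /f /= => FE; rewrite /Rintegral; congr fine.
transitivity (\int[mu]_x \int[mu]_y f (x, y))%E.
  apply: eq_integral => x _; rewrite EFinM fineK; last first.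
    by apply: integrable_fin_num => //; exact: ihk.
  by rewrite -integralZl //; exact: ihk.
rewrite FE; apply: eq_integral => y _; rewrite EFinM fineK; last first.
  by apply: integrable_fin_num => //; exact: igk.
rewrite -integralZl //; last exact: igk.
by apply: eq_integral => x _; rewrite -EFinM mulrCA.
Qed.

End integration_on_the_line.

(** * Differentiation rules for explicit formulas *)

Section derivatives_of_real_functions.
Context {R : realType}.
Implicit Types (f g : R -> R) (x a b c d : R).

Lemma der_ext f g x a : f =1 g -> is_derive x (1 : R) f a -> is_derive x (1 : R) g a.
Proof. by move=> /funext ->. Qed.

Lemma der_derive1 f x a : is_derive x (1 : R) f a -> derive1 f x = a.
Proof. by rewrite derive1E => -[]. Qed.

Lemma derD f g x a b : is_derive x (1 : R) f a -> is_derive x (1 : R) g b ->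
  is_derive x (1 : R) (fun y => f y + g y) (a + b).
Proof. by move=> df dg; exact: (is_deriveD df dg). Qed.

Lemma derB f g x a b : is_derive x (1 : R) f a -> is_derive x (1 : R) g b ->
  is_derive x (1 : R) (fun y => f y - g y) (a - b).
Proof. by move=> df dg; exact: (is_deriveB df dg). Qed.

Lemma derM f g x a b : is_derive x (1 : R) f a -> is_derive x (1 : R) g b ->
  is_derive x (1 : R) (fun y => f y * g y) (a * g x + f x * b).
Proof.
move=> df dg; apply: is_derive_eq (is_deriveM df dg) _.
by rewrite /GRing.scale /= addrC [a * _]mulrC.
Qed.

Lemma derZ f x a c : is_derive x (1 : R) f a ->
  is_derive x (1 : R) (fun y => c * f y) (c * a).
Proof. by move=> df; exact: (is_deriveZ c df). Qed.

Lemma der_cst x c : is_derive x (1 : R) (fun=> c) 0.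
Proof. exact: is_derive_cst. Qed.

Lemma der_id x : is_derive x (1 : R) (fun y => y) 1.
Proof. exact: is_derive_id. Qed.

Lemma der_affine x c d : is_derive x (1 : R) (fun y => c * y + d) c.
Proof.
apply: is_derive_eq (derD (derZ c (der_id x)) (der_cst x d)) _.
by rewrite mulr1 addr0.
Qed.

Lemma der_comp f g x a b : is_derive x (1 : R) g b ->
  is_derive (g x) (1 : R) f a ->
  is_derive x (1 : R) (fun y => f (g y)) (b * a).
Proof.
move=> dg df; apply: is_derive_eq (is_derive1_comp df dg) _.
exact: mulrC.
Qed.

Lemma der_sin f x a : is_derive x (1 : R) f a ->
  is_derive x (1 : R) (fun y => sin (f y)) (a * cos (f x)).
Proof. by move=> df; apply: der_comp df _; exact: is_derive_sin. Qed.

Lemma der_cos f x a : is_derive x (1 : R) f a ->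
  is_derive x (1 : R) (fun y => cos (f y)) (- (a * sin (f x))).
Proof.
move=> df; apply: is_derive_eq (der_comp df (is_derive_cos _)) _.
by rewrite mulrN.
Qed.

Lemma der_expR f x a : is_derive x (1 : R) f a ->
  is_derive x (1 : R) (fun y => expR (f y)) (a * expR (f x)).
Proof. by move=> df; apply: der_comp df _; exact: is_derive_expR. Qed.

Lemma derV f x a : f x != 0 -> is_derive x (1 : R) f a ->
  is_derive x (1 : R) (fun y => (f y)^-1) (- (a / f x ^+ 2)).
Proof.
move=> fx0 df; apply: is_derive_eq (is_deriveV fx0 df) _.
by rewrite /GRing.scale /= mulrC mulrN.
Qed.

Lemma der_continuous f x a : is_derive x (1 : R) f a -> {for x, continuous f}.
Proof. by move=> [df _]; apply/differentiable_continuous/derivable1_diffP. Qed.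

End derivatives_of_real_functions.

(** * Antiderivatives, symmetric limits and the arctangent density *)

Section fundamental_theorem.
Context {R : realType}.
Notation mu := (@lebesgue_measure R).
Implicit Types f g h : R -> R.

Lemma itv_integrable f a b : continuous f -> mu.-integrable `[a, b] (EFin \o f).
Proof.
move=> cf; apply: continuous_compact_integrable; first exact: segment_compact.
exact: continuous_subspaceT.
Qed.

Lemma itv_integral_FTC2 f F a b : a <= b -> continuous f ->
  (forall x, is_derive x (1 : R) F (f x)) -> \int[mu]_(x in `[a, b]) f x = F b - F a.
Proof.
(* The degenerate interval does occur: limits along the integers start at [n = 0]. *)
rewrite le_eqVlt => /predU1P[-> _ _|ab cf dF].
  by rewrite set_itv1 Rintegral_set1 subrr.
have cF : continuous F by move=> x; exact: der_continuous (dF x).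
rewrite /Rintegral (continuous_FTC2 ab (F := F)) //.
- exact: continuous_subspaceT.
- split=> [x _||]; first by case: (dF x).
  + exact/cvg_at_right_filter/cF.
  + exact/cvg_at_left_filter/cF.
- by move=> x _; rewrite derive1E; exact: derive_val.
Qed.

Lemma rint_cvg_symmetric_itv h : L1 h ->
  \int[mu]_(x in `[- n%:R, n%:R]) h x @[n --> \oo] --> rint h.
Proof.
move=> ih; have mh := L1_measurable ih.
under eq_cvg do rewrite Rintegral_mkcond.
apply: (rint_dominated_cvg _ _ (L1_norm ih) _).2.
- by move=> n; apply/(measurable_restrictT _ _).1 => //; exact: measurable_funTS.
- move=> x; apply: cvg_near_cst; exists (Num.truncn `|x|).+1 => // n /= xn.
  rewrite patchE mem_set //= in_itv /= -ler_norml.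
  apply: le_trans (ltW (truncnS_gt _)) _; by rewrite ler_nat.
- by move=> n x; rewrite patchE; case: ifP => _ //; rewrite normr0.
Qed.

Lemma itv_integral_fold h a : 0 <= a -> continuous h ->
  \int[mu]_(x in `[- a, a]) h x = \int[mu]_(x in `[0, a]) (h x + h (- x)).
Proof.
move=> a0 ch.
have chN : continuous (fun x => h (- x)).
  by move=> x; apply: continuous_comp; [exact: opp_continuous|exact: ch].
rewrite RintegralD //; [|exact: itv_integrable..].
have := @integration_by_substitution_oppr R h 0 a a0 (continuous_subspaceT ch).
rewrite oppr0 => hN.
rewrite (_ : Rintegral mu `[0, a] (fun x => h (- x)) = \int[mu]_(x in `[- a, 0]) h x);
  last by rewrite /Rintegral hN.
rewrite addrC (@itv_bndbnd_setU _ _ _ (BRight 0)) ?bnd_simp ?oppr_le0 //.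
rewrite Rintegral_setU //=.
- rewrite (Rintegral_itv_obnd_cbnd (r := 0)) //.
  by apply: integrableS (itv_integrable 0 a ch) => //; exact: subset_itv_oc_cc.
- apply: integrableS (itv_integrable (- a) a ch) => //; first exact: measurableU.
  by move=> x [] /=; rewrite !in_itv /= => /andP[? ?]; apply/andP; split; lra.
- by apply/disj_setPS => x /= []; rewrite !in_itv /= => /andP[? ?] /andP[? ?]; lra.
Qed.

(** The bridge between the line and the half line, used for the even weight [exp (- e |x|)] and for
    the Airy integral over [[0, n]]. *)
Lemma rint_cvg_fold h : L1 h -> continuous h ->
  \int[mu]_(x in `[0, n%:R]) (h x + h (- x)) @[n --> \oo] --> rint h.
Proof.
move=> ih ch; under eq_cvg do rewrite -itv_integral_fold //.
exact: rint_cvg_symmetric_itv.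
Qed.

(** This function is the majorant in most integrability arguments below; its mass is also that of
    the Poisson kernel, hence the factor [pi] in the inversion formula. *)
Lemma L1_oneDsqrV : L1 (fun x : R => (1 + x ^+ 2)^-1) /\
  rint (fun x : R => (1 + x ^+ 2)^-1) = pi.
Proof.
have cf := @continuous_oneDsqrV R.
have f0 (x : R) : 0 <= (oneDsqr x)^-1 by rewrite invr_ge0 ltW ?oneDsqr_gt0.
have intE : (\int[mu]_x ((oneDsqr x)^-1)%:E = pi%:E)%E.
  rewrite ge0_symfun_integralT //=; last first.
    by move=> x /=; rewrite /oneDsqr sqrrN.
  rewrite (_ : [set x | _] = `[0, +oo[%classic); last first.
    by apply/seteqP; split => x/=; rewrite in_itv/= andbT.
  by rewrite integral0y_oneDsqr -EFinM mulrCA divff// mulr1.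
split; last by rewrite /Rintegral intE.
have mf : measurable_fun setT (EFin \o (fun x : R => (1 + x ^+ 2)^-1)).
  by apply/measurable_EFinP; exact: continuous_measurable_fun cf.
apply/integrableP; split; first exact: mf.
apply: (@le_lt_trans _ _ pi%:E); last exact: ltry.
rewrite -intE le_eqVlt; apply/orP; left; apply/eqP; apply: eq_integral => x _ /=.
by congr EFin; rewrite ger0_norm //; exact: f0.
Qed.

End fundamental_theorem.

(** * Affine change of variable on the line *)

Section affine_substitution.
Context {R : realType}.
Notation mu := (@lebesgue_measure R).
Implicit Types (f g h : R -> R) (a b c d : R).

Lemma ge0_integral_affine h c d : 0 < c -> continuous h -> (forall x, 0 <= h x) ->
  (\int[mu]_x (h x)%:E = \int[mu]_x (h (c * x + d) * c)%:E)%E.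
Proof.
move=> c0 ch h0; pose F (x : R) := c * x + d.
have dF x : is_derive x (1 : R) F c by exact: der_affine.
have F'E : derive1 F = cst c by apply/funext => x; rewrite derive1E; exact: derive_val.
rewrite (@increasing_ge0_integration_by_substitutionT R F h) ?F'E //.
- by move=> x y xy; rewrite /F ltrD2r ltr_pM2l.
- by move=> x; exact: cvg_cst.
- exact: is_cvg_cst.
- exact: is_cvg_cst.
- apply/cvgrNyPle => A; apply: filterS (nbhs_ninfty_le (num_real ((A - d) / c))).
  by move=> x xA; rewrite /F -lerBrDr mulrC -ler_pdivlMr.
- apply/cvgryPge => A; apply: filterS (nbhs_pinfty_ge (num_real ((A - d) / c))).
  by move=> x xA; rewrite /F -lerBlDr mulrC -ler_pdivrMr.
Qed.

(** The nonnegative case comes first; a signed [h] is then the difference of [h + |h|] and [|h|],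
    both nonnegative, continuous and integrable. *)
Lemma rint_affine h c d : 0 < c -> continuous h -> L1 h ->
  L1 (fun x => h (c * x + d)) /\ rint (fun x => h (c * x + d)) = c^-1 * rint h.
Proof.
move=> c0 ch ih.
have cF : continuous (fun x : R => c * x + d).
  by move=> x; exact: der_continuous (der_affine x c d).
have cn : continuous (fun x => `|h x|).
  by move=> x; apply: continuous_comp; [exact: ch|exact: norm_continuous].
have ge0 g : continuous g -> L1 g -> (forall x, 0 <= g x) ->
    L1 (fun x => g (c * x + d)) /\ rint (fun x => g (c * x + d)) = c^-1 * rint g.
  move=> cg ig g0; have E := ge0_integral_affine d c0 cg g0.
  have mgF : measurable_fun setT (fun x => g (c * x + d)).
    by apply: continuous_measurable_fun => x; apply: continuous_comp; [exact: cF|exact: cg].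
  have igF : L1 (fun x => c * g (c * x + d)).
    have mf : measurable_fun setT (EFin \o (fun x => c * g (c * x + d))).
      by apply/measurable_EFinP; exact: measurable_funM.
    apply/integrableP; split; first exact: mf.
    apply: (@le_lt_trans _ _ (\int[mu]_x (g x)%:E)%E).
      rewrite E le_eqVlt; apply/orP; left; apply/eqP; apply: eq_integral => x _ /=.
      by congr EFin; rewrite mulrC ger0_norm // mulr_ge0 // ltW.
    rewrite ltey_eq; apply/orP; left.
    exact: (integrable_fin_num measurableT ig).
  have igF' : L1 (fun x => g (c * x + d)).
    have := L1Z c^-1 igF; rewrite (_ : (fun x => c^-1 * (c * _)) =
      (fun x => g (c * x + d))) //; apply/funext => x.
    by rewrite mulKf // gt_eqF.
  split=> //; rewrite [rint g]/Rintegral E.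
  transitivity (c^-1 * (c * rint (fun x => g (c * x + d)))).
    by rewrite mulKf // gt_eqF.
  rewrite -rintZ //; congr (_ * fine _); apply: eq_integral => x _.
  by rewrite mulrC.
have [i1 e1] := ge0 _ cn (L1_norm ih) (fun x => normr_ge0 (h x)).
have [|||i2 e2] := ge0 (fun x => h x + `|h x|).
- by move=> x; apply: cvgD; [exact: ch|exact: cn].
- exact: L1D ih (L1_norm ih).
- by move=> x; have := ler_norm (- h x); rewrite normrN; lra.
have hE : (fun x => h (c * x + d)) =
    (fun x => (h (c * x + d) + `|h (c * x + d)|) - `|h (c * x + d)|).
  by apply/funext => x; rewrite addrK.
rewrite hE; split; first exact: L1B.
rewrite rintB // e1 e2 rintD //; last exact: L1_norm.
by rewrite mulrDr addrK.
Qed.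

End affine_substitution.

(** * Real Schwartz functions *)

Section real_schwartz.
Context {R : realType}.
Notation mu := (@lebesgue_measure R).
Implicit Types (f g h : R -> R) (a b c d : R).

Definition rschwartz f : Prop :=
  (forall n x, derivable (derive1n n f) x 1) /\
  (forall m n : nat, exists C, forall x, `|x| ^+ m * `|derive1n n f x| <= C).

(** A family closed under differentiation contains all iterated derivatives of its members, so decay
    has to be checked on the members alone and no formula for an n-th derivative is ever needed. *)
Lemma rschwartz_coind (P : (R -> R) -> Prop) :
  (forall f, P f -> [/\ forall x, derivable f x 1, P (derive1 f) &
     forall m : nat, exists C, forall x, `|x| ^+ m * `|f x| <= C]) ->
  forall f, P f -> rschwartz f.
Proof.
move=> Pco f Pf.
have Pn n : P (derive1n n f).
  by elim: n => // n /Pco[_ + _]; rewrite derive1nS.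
by split=> [n|m n]; have [] := Pco _ (Pn n).
Qed.

Lemma rschwartz_is_derive f x : rschwartz f -> is_derive x (1 : R) f (derive1 f x).
Proof. by case=> /(_ 0%N x) d _; apply: DeriveDef => //; rewrite derive1E. Qed.

Lemma rschwartz_derive1 f : rschwartz f -> rschwartz (derive1 f).
Proof.
case=> d b; split=> [n x|m n]; first by have := d n.+1 x; rewrite derive1Sn.
by have := b m n.+1; rewrite derive1Sn.
Qed.

Lemma rschwartz_bound f m : rschwartz f -> exists C, forall x, `|x| ^+ m * `|f x| <= C.
Proof. by case=> _ /(_ m 0%N). Qed.

Lemma rschwartz_continuous f : rschwartz f -> continuous f.
Proof. by move=> sf x; exact: der_continuous (rschwartz_is_derive x sf). Qed.

Lemma rschwartz_measurable f : rschwartz f -> measurable_fun setT f.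
Proof. by move=> /rschwartz_continuous/continuous_measurable_fun. Qed.

Lemma rschwartz_lin a b f g : rschwartz f -> rschwartz g ->
  rschwartz (fun x => a * f x + b * g x).
Proof.
move=> sf sg.
apply: (@rschwartz_coind (fun k => exists f g, [/\ rschwartz f, rschwartz g &
  k = fun x => a * f x + b * g x])); last by exists f, g.
move=> k [f1 [g1 [sf1 sg1 ->]]].
have dk x : is_derive x (1 : R) (fun x => a * f1 x + b * g1 x)
    (a * derive1 f1 x + b * derive1 g1 x).
  by apply: derD; apply: derZ; exact: rschwartz_is_derive.
split; first by move=> x; case: (dk x).
  exists (derive1 f1), (derive1 g1); split; try exact: rschwartz_derive1.
  by apply/funext => x; rewrite (der_derive1 (dk x)).
move=> m; have [C1 h1] := rschwartz_bound m sf1; have [C2 h2] := rschwartz_bound m sg1.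
exists (`|a| * C1 + `|b| * C2) => x.
apply: le_trans (_ : _ <= `|a| * (`|x| ^+ m * `|f1 x|) + `|b| * (`|x| ^+ m * `|g1 x|)) _.
  rewrite !(mulrCA _ (_ ^+ m)) -mulrDr ler_wpM2l ?exprn_ge0 //.
  by apply: le_trans (ler_normD _ _) _; rewrite !normrM.
by apply: lerD; apply: ler_wpM2l.
Qed.

Lemma rschwartzD f g : rschwartz f -> rschwartz g -> rschwartz (fun x => f x + g x).
Proof.
move=> sf sg; have := rschwartz_lin 1 1 sf sg.
by rewrite (_ : (fun x => _) = (fun x => f x + g x)) //; apply/funext => x; rewrite !mul1r.
Qed.

Lemma rschwartz_mulX f : rschwartz f -> rschwartz (fun x => x * f x).
Proof.
move=> sf.
(* The products [x * f x] are not closed under differentiation, as [x f' + f] shows; a free Schwartz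
   summand closes the family. It is zero at the start. *)
apply: (@rschwartz_coind (fun k => exists f g, [/\ rschwartz f, rschwartz g &
  k = fun x => x * f x + g x])); last first.
  exists f, (fun x => 0 * f x + 0 * f x); split=> //; first exact: rschwartz_lin.
  by apply/funext => x; rewrite !mul0r !addr0.
move=> k [f1 [g1 [sf1 sg1 ->]]].
have dk x : is_derive x (1 : R) (fun x => x * f1 x + g1 x)
    ((1 * f1 x + x * derive1 f1 x) + derive1 g1 x).
  apply: derD; last exact: rschwartz_is_derive.
  by apply: derM; exact: rschwartz_is_derive.
split; first by move=> x; case: (dk x).
  exists (derive1 f1), (fun x => f1 x + derive1 g1 x); split.
  - exact: rschwartz_derive1.
  - by apply: rschwartzD => //; exact: rschwartz_derive1.
  apply/funext => x; rewrite (der_derive1 (dk x)); ring.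
move=> m; have [C1 h1] := rschwartz_bound m.+1 sf1; have [C2 h2] := rschwartz_bound m sg1.
exists (C1 + C2) => x; apply: le_trans (lerD (h1 x) (h2 x)).
rewrite exprSr -mulrA -mulrDr ler_wpM2l ?exprn_ge0 // -normrM; exact: ler_normD.
Qed.

Lemma rschwartz_L1 f : rschwartz f -> L1 f.
Proof.
move=> sf; have [C0 h0] := rschwartz_bound 0 sf; have [C2 h2] := rschwartz_bound 2 sf.
apply: (L1_le (rschwartz_measurable sf) (L1Z (C0 + C2) (proj1 (@L1_oneDsqrV R)))).
move=> x; rewrite ler_pdivlMr ?ltr_wpDr ?sqr_ge0 // mulrC mulrDl.
by have := lerD (h0 x) (h2 x); rewrite expr0 real_normK ?num_real.
Qed.

End real_schwartz.

(** * The shifted cosine transforms *)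

Section cosine_transform.
Context {R : realType}.
Notation mu := (@lebesgue_measure R).
Implicit Types (f g h : R -> R) (a b c d x y z : R).

(** The free shift makes this a single family closed under the operations of Fourier analysis:
    differentiating the transform and multiplying it by its variable both replace [b] by
    [b + pi / 2]. *)
Definition costr b f y : R := rint (fun x => cos (y * x + b) * f x).

Lemma measurable_cos_affine y b : measurable_fun setT (fun x : R => cos (y * x + b)).
Proof.
apply: continuous_measurable_fun => x.
exact: der_continuous (der_cos (der_affine x y b)).
Qed.

Lemma cos_L1 y b f : L1 f -> L1 (fun x => cos (y * x + b) * f x).
Proof.
by apply: (@L1_mul_bounded _ 1) => [|x]; [exact: measurable_cos_affine|exact: cos_max].
Qed.

Lemma costr_bound b f y : L1 f -> `|costr b f y| <= rint (fun x => `|f x|).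
Proof.
move=> lf; apply: le_norm_rint (cos_L1 y b lf) (L1_norm lf) _ => x.
by rewrite normrM ler_piMl // cos_max.
Qed.

(** Differentiation under the integral: [|x f(x)|] dominates the derivative of the integrand
    uniformly in the frequency, and [- sin] is the cosine shifted by [pi / 2]. *)
Lemma costr_is_derive b f y : L1 f -> L1 (fun x => x * f x) ->
  is_derive y (1 : R) (costr b f) (costr (b + pi / 2) (fun x => x * f x) y).
Proof.
move=> lf lxf; pose k (z x : R) := cos (z * x + b) * f x.
have dk z x : is_derive z (1 : R) (k ^~ x) (cos (z * x + (b + pi / 2)) * (x * f x)).
  have := derM (der_cos (der_affine z x b)) (der_cst z (f x)).
  move=> dk; apply: (@der_ext _ (fun y => cos (x * y + b) * f x)).
    by move=> w; rewrite /k (mulrC x).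
  by apply: is_derive_eq dk _; rewrite addrA cosDpihalf (mulrC z x); ring.
have d1k z x : partial1of2 k z x = cos (z * x + (b + pi / 2)) * (x * f x).
  by rewrite partial1of2E; have [] := dk z x.
have Iy : `]y - 1, y + 1[%classic y by rewrite /= in_itv /=; apply/andP; split; lra.
have ik z : `]y - 1, y + 1[%classic z -> mu.-integrable setT (EFin \o k z).
  by move=> _; exact: cos_L1.
have derk z x : `]y - 1, y + 1[%classic z -> setT x -> derivable (k ^~ x) z 1.
  by move=> _ _; have [] := dk z x.
have kle z x : `]y - 1, y + 1[%classic z -> setT x -> `|partial1of2 k z x| <= `|x * f x|.
  by move=> _ _; rewrite d1k normrM ler_piMl // cos_max.
apply: DeriveDef.
  exact: (derivable_under_integral measurableT Iy ik derk _ (L1_norm lxf) kle).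
rewrite -derive1E.
rewrite (differentiation_under_integral measurableT Iy ik derk _ (L1_norm lxf) kle) //.
by apply: rint_ext => x; exact: d1k.
Qed.

Lemma costr_continuous b f : L1 f -> L1 (fun x => x * f x) -> continuous (costr b f).
Proof. by move=> lf lxf y; exact: der_continuous (costr_is_derive b y lf lxf). Qed.

Lemma rschwartz_cvg0 f : rschwartz f ->
  f n%:R @[n --> \oo] --> 0 /\ f (- n%:R) @[n --> \oo] --> 0.
Proof.
move=> sf; have [C hC] := rschwartz_bound 1 sf.
have c0 : C * (n.+1%:R^-1 : R) @[n --> \oo] --> 0.
  by rewrite -(mulr0 C); apply: cvgM; [exact: cvg_cst|exact: cvg_harmonic].
have le n x : `|x| = n.+1%:R -> `|f x| <= C * n.+1%:R^-1.
  by move=> xn; rewrite ler_pdivlMr ?ltr0n // mulrC -xn -[`|x|]expr1.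
split; rewrite -cvg_shiftS; apply: norm_cvg0.
- by apply: (squeeze_cvgr _ (cvg_cst 0) c0); near=> n; rewrite normr_ge0 le // normr_nat.
- apply: (squeeze_cvgr _ (cvg_cst 0) c0); near=> n.
  by rewrite normr_ge0 le // normrN normr_nat.
Unshelve. all: by end_near. Qed.

Lemma costr_mulX b f y : rschwartz f ->
  y * costr b f y = costr (b + pi / 2) (derive1 f) y.
Proof.
move=> sf; have lf := rschwartz_L1 sf.
have sf' := rschwartz_derive1 sf; have lf' := rschwartz_L1 sf'.
(* Integration by parts: [H] is the boundary term and [h] its derivative. As [H] vanishes at both
   infinities, the integral of [h] is zero. *)
pose H x := sin (y * x + b) * f x.
pose h x := y * (cos (y * x + b) * f x) - cos (y * x + (b + pi / 2)) * derive1 f x.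
have dH x : is_derive x (1 : R) H (h x).
  have := derM (der_sin (der_affine x y b)) (rschwartz_is_derive x sf).
  by rewrite /h addrA cosDpihalf mulrA mulNr opprK.
have lh : L1 h by apply: L1B; [exact/L1Z/cos_L1|exact: cos_L1].
have ch : continuous h.
  move=> x; apply: (@continuousB _ _ _ (fun x => y * (cos (y * x + b) * f x))
      (fun x => cos (y * x + (b + pi / 2)) * derive1 f x)).
    apply: (@continuousM _ _ (fun=> y) (fun x => cos (y * x + b) * f x)).
      exact: cst_continuous.
    exact: der_continuous (derM (der_cos (der_affine x y b)) (rschwartz_is_derive x sf)).
  exact: der_continuous (derM (der_cos (der_affine x y _)) (rschwartz_is_derive x sf')).
have := rint_cvg_symmetric_itv lh.
have -> : (fun n : nat => \int[mu]_(x in `[- n%:R, n%:R]) h x) =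
    (fun n => H n%:R - H (- n%:R)).
  by apply/funext => n; apply: itv_integral_FTC2 => //; have := ler0n R n; lra.
have H0 (u_ : R^nat) : f (u_ n) @[n --> \oo] --> 0 -> H (u_ n) @[n --> \oo] --> 0.
  move=> fu; apply: norm_cvg0.
  have fu' : `|f (u_ n)| @[n --> \oo] --> 0.
    by rewrite -(@normr0 _ R); exact: cvg_norm.
  apply: (squeeze_cvgr _ (cvg_cst 0) fu'); near=> n.
  by rewrite normr_ge0 /H normrM ler_piMl // sin_max.
have [fp fm] := rschwartz_cvg0 sf.
have cH : H n%:R - H (- n%:R) @[n --> \oo] --> (0 : R).
  by rewrite -(subr0 0); apply: cvgB; exact: H0.
move=> ci; have : 0 = rint h.
  by rewrite -(cvg_lim _ ci) // -(cvg_lim _ cH).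
move=> /esym; rewrite /h rintB; [|exact/L1Z/cos_L1|exact: cos_L1].
by rewrite rintZ; [move/eqP; rewrite subr_eq0 => /eqP|exact: cos_L1].
Unshelve. all: by end_near. Qed.

Lemma rschwartz_costr b f : rschwartz f -> rschwartz (costr b f).
Proof.
move=> sf0.
apply: (@rschwartz_coind _ (fun k => exists b f, rschwartz f /\ k = costr b f));
  last by exists b, f.
move=> k [{sf0}{}b [{}f [sf ->]]].
have sxf := rschwartz_mulX sf.
have dk y := costr_is_derive b y (rschwartz_L1 sf) (rschwartz_L1 sxf).
split; first by move=> y; case: (dk y).
  exists (b + pi / 2), (fun x => x * f x); split=> //.
  by apply/funext => y; rewrite (der_derive1 (dk y)).
(* Decay of order [m + 1] for [f] at shift [b] is decay of order [m] for [f'] at shift [b + pi / 2],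
   so the induction has to range over all [b] and [f]. *)
move=> m; elim: m b f sf {sxf dk} => [|m IH] b f sf.
  exists (rint (fun x => `|f x|)) => y; rewrite expr0 mul1r.
  exact/costr_bound/rschwartz_L1.
have [C hC] := IH (b + pi / 2) _ (rschwartz_derive1 sf).
by exists C => y; rewrite exprSr -mulrA -normrM costr_mulX.
Qed.

End cosine_transform.

(** * The Poisson kernel and Fourier inversion *)

Section poisson_kernel.
Context {R : realType}.
Notation mu := (@lebesgue_measure R).
Implicit Types (f g h : R -> R) (a b c d e x y z : R).

Definition poisson e y : R := e / (e ^+ 2 + y ^+ 2).

Lemma poisson_denom_gt0 e y : 0 < e -> 0 < e ^+ 2 + y ^+ 2.
Proof. by move=> e0; rewrite ltr_wpDr ?sqr_ge0 // exprn_gt0. Qed.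

Lemma poisson_continuous e : 0 < e -> continuous (poisson e).
Proof.
move=> e0 y; apply: (@continuousM _ _ (fun=> e) (fun y => (e ^+ 2 + y ^+ 2)^-1)).
  exact: cst_continuous.
apply: (@continuousV _ _ (fun y => e ^+ 2 + y ^+ 2)).
  by rewrite gt_eqF // poisson_denom_gt0.
apply: (@continuousD _ _ _ (fun=> e ^+ 2) (fun y => y ^+ 2)).
  exact: cst_continuous.
exact: exprn_continuous.
Qed.

Lemma poisson_bound e y : 0 < e -> `|poisson e y| <= e^-1.
Proof.
move=> e0; have d0 := poisson_denom_gt0 y e0.
rewrite /poisson ger0_norm; last by rewrite divr_ge0 // ltW.
rewrite ler_pdivrMr // -ler_pdivrMl ?invr_gt0 // invrK -expr2 lerDl; exact: sqr_ge0.
Qed.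

Lemma expR_abs_continuous e : continuous (fun x => expR (- (e * `|x|))).
Proof.
move=> x; apply: (@continuous_comp _ _ _ (fun x => - (e * `|x|)) expR).
  apply: (@continuousN _ _ _ (fun x => e * `|x|)).
  apply: (@continuousM _ _ (fun=> e) (fun x => `|x|)); first exact: cst_continuous.
  exact: norm_continuous.
exact: continuous_expR.
Qed.

(** Squaring [1 + t / 2 <= exp (t / 2)] gives [1 + t^2 / 4 <= exp t]. With [t = e |x|], the factor
    [1 + 4 / e^2] is chosen so that its product with the left side exceeds [1 + x^2]. *)
Lemma expR_abs_L1 e : 0 < e -> L1 (fun x => expR (- (e * `|x|))).
Proof.
move=> e0.
have mw := continuous_measurable_fun (@expR_abs_continuous e).
apply: (L1_le mw (L1Z (1 + 4 / e ^+ 2) (proj1 (@L1_oneDsqrV R)))) => x.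
have e2 : 0 < e ^+ 2 by rewrite exprn_gt0.
rewrite ger0_norm ?expR_ge0 // ler_pdivlMr ?ltr_wpDr ?sqr_ge0 // mulrC expRN.
rewrite ler_pdivrMr ?expR_gt0 //.
set t := e * `|x|; have t0 : 0 <= t by rewrite mulr_ge0 // ltW.
have E : 1 + t ^+ 2 / 4 <= expR t.
  have h : 1 + t / 2 <= expR (t / 2) by exact: expR_ge1Dx.
  have -> : expR t = expR (t / 2) ^+ 2.
    by rewrite expr2 -expRD; congr expR; lra.
  apply: le_trans (_ : (1 + t / 2) ^+ 2 <= _); last first.
    by rewrite ler_sqr ?nnegrE ?expR_ge0 //; lra.
  by nra.
apply: le_trans (_ : (1 + 4 / e ^+ 2) * (1 + t ^+ 2 / 4) <= _); last first.
  by apply: ler_wpM2l => //; rewrite addr_ge0 // divr_ge0 // ltW.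
have -> : (1 + 4 / e ^+ 2) * (1 + t ^+ 2 / 4) = 1 + x ^+ 2 + (t ^+ 2 / 4 + 4 / e ^+ 2).
  rewrite /t exprMn real_normK ?num_real //; field; lra.
by rewrite lerDl addr_ge0 // divr_ge0 ?sqr_ge0 // ltW.
Qed.

Lemma cvg_expR_Mn e : 0 < e -> expR (- (e * n%:R)) @[n --> \oo] --> 0.
Proof.
move=> e0.
have -> : (fun n : nat => expR (- (e * n%:R))) = (fun n => expR (- e) ^+ n).
  by apply/funext => n; rewrite -expRM_natr mulNr.
by apply: cvg_expr; rewrite ger0_norm ?expR_ge0 // -expR0 ltr_expR oppr_lt0.
Qed.

Lemma rint_cos_expR_abs e z c : 0 < e ->
  rint (fun x => expR (- (e * `|x|)) * cos (x * z + c)) = 2 * cos c * poisson e z.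
Proof.
move=> e0; have d0 := poisson_denom_gt0 z e0.
pose h x := expR (- (e * `|x|)) * cos (x * z + c).
have ch : continuous h.
  move=> x; apply: (@continuousM _ _ (fun x => expR (- (e * `|x|))) (fun x => cos (x * z + c))).
    exact: expR_abs_continuous.
  by apply: (@der_continuous _ _ x); apply: der_cos; apply: derD; apply: derM.
have lh : L1 h.
  rewrite /h; under eq_fun do rewrite mulrC.
  apply: (@L1_mul_bounded _ 1); last exact: expR_abs_L1.
    under eq_fun do rewrite (mulrC _ z); exact: measurable_cos_affine.
  by move=> x; exact: cos_max.
(* Folding cancels the odd part, which carries [sin c], and leaves [p]. Its antiderivative [F] tends
   to 0 at infinity, so the integral equals [- F 0]. *)
pose p x := 2 * cos c * (expR (- (e * x)) * cos (x * z)).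
pose F x := 2 * cos c / (e ^+ 2 + z ^+ 2) *
   (expR (- (e * x)) * (z * sin (x * z) - e * cos (x * z))).
have dz x : is_derive x (1 : R) (fun x => x * z) z.
  by apply: is_derive_eq (derM (der_id x) (der_cst x z)) _; rewrite mulr0 addr0 mul1r.
have dex x : is_derive x (1 : R) (fun x => expR (- (e * x))) (- e * expR (- (e * x))).
  apply: der_expR; apply: (@der_ext _ (fun x => (- e) * x + 0)); last exact: der_affine.
  by move=> y; rewrite addr0 mulNr.
have dF x : is_derive x (1 : R) F (p x).
  have := derZ (2 * cos c / (e ^+ 2 + z ^+ 2)) (derM (dex x)
    (derB (derZ z (der_sin (dz x))) (derZ e (der_cos (dz x))))).
  move=> dF; apply: is_derive_eq dF _; rewrite /p; field; lra.
have cp : continuous p.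
  move=> x; exact: der_continuous (derZ (2 * cos c) (derM (dex x) (der_cos (dz x)))).
have := rint_cvg_fold lh ch.
have -> : (fun n : nat => \int[mu]_(x in `[0, n%:R]) (h x + h (- x))) =
    (fun n => F n%:R - F 0).
  apply/funext => n; rewrite -(itv_integral_FTC2 _ cp dF) ?ler0n //.
  apply: eq_Rintegral => x; rewrite inE /= in_itv /= => /andP[x0 _].
  rewrite /h /p normrN ger0_norm // -mulrDr mulrCA; congr (_ * _).
  by rewrite mulNr !cosD cosN sinN; ring.
have cF : F n%:R - F 0 @[n --> \oo] --> 0 - F 0.
  apply: cvgB; last exact: cvg_cst.
  rewrite -(mulr0 (2 * cos c / (e ^+ 2 + z ^+ 2))); apply: cvgM; first exact: cvg_cst.
  apply: norm_cvg0.
  have c0 : (`|z| + e) * expR (- (e * n%:R)) @[n --> \oo] --> (0 : R).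
    by rewrite -(mulr0 (`|z| + e)); apply: cvgM; [exact: cvg_cst|exact: cvg_expR_Mn].
  apply: (squeeze_cvgr _ (cvg_cst 0) c0); near=> n.
  rewrite normr_ge0 /= normrM (ger0_norm (expR_ge0 _)) mulrC ler_wpM2r ?expR_ge0 //.
  apply: le_trans (ler_normB _ _) _; rewrite !normrM (gtr0_norm e0).
  by apply: lerD; rewrite ler_piMr // ?sin_max ?cos_max // ltW.
move=> ci; have <- : 0 - F 0 = rint h.
  by rewrite -(cvg_lim _ ci) // -(cvg_lim _ cF).
rewrite /F /poisson mulr0 oppr0 expR0 !mul0r sin0 cos0; ring.
Unshelve. all: by end_near. Qed.

Lemma poisson_approximation f y (e_ : R^nat) (M : R) : continuous f -> L1 f ->
  (forall x, `|f x| <= M) -> (forall n, 0 < e_ n) -> e_ n @[n --> \oo] --> 0 ->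
  rint (fun x => poisson (e_ n) (x - y) * f x) @[n --> \oo] --> pi * f y.
Proof.
move=> cf lf fM e0 ce; have [lo intp] := @L1_oneDsqrV R.
(* Rescaling moves [e_ n] from the kernel into the argument of [f]: the kernel becomes the fixed
   density [1 / (1 + x^2)], and boundedness of [f] provides the majorant. *)
have E n : rint (fun x => poisson (e_ n) (x - y) * f x) =
    rint (fun x => f (e_ n * x + y) * (1 + x ^+ 2)^-1).
  have cP : continuous (fun x => poisson (e_ n) (x - y)).
    move=> x; apply: (@continuous_comp _ _ _ (fun x => x - y)).
      by apply: (@der_continuous _ _ x); apply: derB.
    exact: poisson_continuous.
  have [||lP] := @rint_affine R (fun x => poisson (e_ n) (x - y) * f x) (e_ n) y (e0 n).
  - by move=> x; apply: (@continuousM _ _ (fun x => poisson (e_ n) (x - y)) f);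
      [exact: cP|exact: cf].
  - apply: (@L1_mul_bounded _ (e_ n)^-1) => //; first exact: continuous_measurable_fun.
    by move=> x; exact: poisson_bound.
  move=> /(congr1 (fun t => e_ n * t)); rewrite mulVKf ?gt_eqF // => <-.
  rewrite -rintZ //; apply: rint_ext => x; rewrite addrK /poisson.
  have := e0 n; move: (f _) => F en0; field.
  have e2 : 0 < e_ n ^+ 2 by rewrite exprn_gt0.
  have x2 := sqr_ge0 x; have ex2 := sqr_ge0 (e_ n * x).
  by rewrite !gt_eqF // ltr_wpDr.
under eq_cvg do rewrite E.
rewrite -intp mulrC -rintZ //.
apply: (rint_dominated_cvg _ _ (L1Z M lo) _).2.
- move=> n; apply: measurable_funM; last exact: L1_measurable.
  apply: continuous_measurable_fun => x; apply: (@continuous_comp _ _ _ (fun x => e_ n * x + y)).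
    exact: der_continuous (der_affine x _ _).
  exact: cf.
- move=> x; apply: cvgM; last exact: cvg_cst.
  have cy : e_ n * x + y @[n --> \oo] --> y.
    rewrite -[X in _ --> X]add0r -(mul0r x); apply: cvgD; last exact: cvg_cst.
    by apply: cvgM; [exact: ce|exact: cvg_cst].
  exact: (@cvg_comp _ _ _ _ f _ _ _ cy (cf y)).
- move=> n x; rewrite normrM (@ger0_norm _ (_^-1)) ?invr_ge0 ?addr_ge0 ?sqr_ge0 //.
  by rewrite ler_wpM2r ?invr_ge0 ?addr_ge0 ?sqr_ge0.
Qed.

Theorem costr_inversion a b f y : rschwartz f ->
  costr a (costr b f) y = pi * (cos (a + b) * f (- y) + cos (a - b) * f y).
Proof.
move=> sf; have lf := rschwartz_L1 sf; have cf := rschwartz_continuous sf.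
have sg := rschwartz_costr b sf; have lg := rschwartz_L1 sg.
have [M fM'] := rschwartz_bound 0 sf.
have {fM'} fM x : `|f x| <= M by have := fM' x; rewrite expr0 mul1r.
pose e_ n : R := n.+1%:R^-1.
have e0 n : 0 < e_ n by rewrite invr_gt0.
have ce : e_ n @[n --> \oo] --> 0 by exact: cvg_harmonic.
pose I_ n := rint (fun x => expR (- (e_ n * `|x|)) * (cos (y * x + a) * costr b f x)).
have I1 : I_ n @[n --> \oo] --> costr a (costr b f) y.
  (* The weight is at most 1, so the Schwartz function [costr b f] itself dominates. *)
  apply: (rint_dominated_cvg _ _ (L1_norm lg) _).2.
  - move=> n; apply: measurable_funM; last exact: (L1_measurable (cos_L1 y a lg)).
    by apply: continuous_measurable_fun; exact: expR_abs_continuous.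
  - move=> x; rewrite -[X in _ --> X]mul1r; apply: cvgM; last exact: cvg_cst.
    have c0 : - (e_ n * `|x|) @[n --> \oo] --> (0 : R).
      by rewrite -oppr0 -(mul0r `|x|); apply: cvgN; apply: cvgM; [exact: ce|exact: cvg_cst].
    by rewrite -[X in _ --> X](@expR0 R); exact: (@cvg_comp _ _ _ _ expR _ _ _ c0 (@continuous_expR R 0)).
  - move=> n x; rewrite !normrM mulrA ler_piMl // mulr_ile1 ?cos_max //.
    by rewrite ger0_norm ?expR_ge0 // -expR0 ler_expR oppr_le0 mulr_ge0 // ltW.
have I2 n : I_ n = cos (a + b) * rint (fun x => poisson (e_ n) (x - - y) * f x) +
    cos (a - b) * rint (fun x => poisson (e_ n) (x - y) * f x).
  have lP z : L1 (fun x => poisson (e_ n) (x - z) * f x).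
    apply: (@L1_mul_bounded _ (e_ n)^-1) => //; last by move=> x; exact: poisson_bound.
    apply: continuous_measurable_fun => x; apply: (@continuous_comp _ _ _ (fun x => x - z)).
      by apply: (@der_continuous _ _ x); apply: derB.
    exact: poisson_continuous.
  have lw := expR_abs_L1 (e0 n).
  transitivity (rint (fun x => expR (- (e_ n * `|x|)) *
      rint (fun t => f t * (cos (y * x + a) * cos (x * t + b))))).
    apply: rint_ext => x; congr (_ * _); rewrite /costr -rintZ; last exact: cos_L1.
    by apply: rint_ext => t; ring.
  rewrite rint_fubini //; last 2 first.
  - apply: measurable_funM.
      apply: (measurableT_comp (measurable_cos_affine y a)); exact: measurable_fst.
    apply: (measurableT_comp (continuous_measurable_fun (@continuous_cos R))).
    apply: measurable_funD => //.
    by apply: measurable_funM; [exact: measurable_fst|exact: measurable_snd].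
  - by move=> x t; rewrite normrM mulr_ile1 ?cos_max.
  rewrite -!rintZ // -rintD; [|exact/L1Z/lP..].
  apply: rint_ext => t.
  (* The product formula for cosines splits the inner integral into two weighted cosines, which
     yield Poisson kernels centred at [- y] and at [y]. *)
  transitivity (f t * rint (fun x => 2^-1 *
      (expR (- (e_ n * `|x|)) * cos (x * (t - - y) + (a + b)) +
       expR (- (e_ n * `|x|)) * cos (x * (t - y) + (b - a))))).
    congr (_ * _); apply: rint_ext => x.
    have -> : x * (t - - y) + (a + b) = (y * x + a) + (x * t + b) by ring.
    have -> : x * (t - y) + (b - a) = (x * t + b) - (y * x + a) by ring.
    by move: (y * x + a) (x * t + b) => A B; rewrite cosD cosB; field.
  have lc z c : L1 (fun x => expR (- (e_ n * `|x|)) * cos (x * z + c)).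
    under eq_fun do rewrite mulrC (mulrC _ z).
    exact: cos_L1.
  rewrite rintZ; last exact: L1D.
  rewrite rintD // !rint_cos_expR_abs //.
  have -> : cos (b - a) = cos (a - b) by rewrite -cosN opprB.
  by field.
have : I_ n @[n --> \oo] --> cos (a + b) * (pi * f (- y)) + cos (a - b) * (pi * f y).
  under eq_cvg do rewrite I2.
  by apply: cvgD; (apply: cvgM; [exact: cvg_cst|exact: poisson_approximation]).
move=> ci; rewrite -(cvg_lim _ I1) // (cvg_lim _ ci) //.
by ring.
Qed.

End poisson_kernel.

(** * Truncated Airy integrals: bounds and convergence *)

Section oscillatory_integral.
Context {R : realType}.
Notation mu := (@lebesgue_measure R).
Variables (alpha t : R).
Hypotheses (alpha1 : 1 < alpha) (t0 : 0 < t).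
Implicit Types (f g h : R -> R) (a b c d e x y z s A : R).

Lemma abs_powR_continuous (p : R) : 0 < p -> continuous (fun s : R => `|s| `^ p).
Proof.
move=> p0 s; have [->|s0] := eqVneq s 0.
  rewrite /continuous_at normr0 powR0 ?gt_eqF //.
  apply/cvgrPdist_lt => e e0; near=> x; rewrite sub0r normrN ger0_norm ?powR_ge0 //.
  rewrite (_ : e = (e `^ p^-1) `^ p); last by rewrite -powRrM mulVf ?gt_eqF // powRr1 // ltW.
  rewrite gt0_ltr_powR ?nnegrE ?powR_ge0 //.
  near: x; exists (e `^ p^-1) => /=; first exact: powR_gt0.
  by move=> x /=; rewrite sub0r normrN.
apply: (@continuous_comp _ _ _ (fun s : R => `|s|) (fun s => s `^ p)).
  exact: norm_continuous.
apply/differentiable_continuous/derivable1_diffP; apply: derivable_powR.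
by rewrite in_itv /= andbT normr_gt0.
Unshelve. all: by end_near. Qed.

(* [`|s|] instead of [s] keeps the phase continuous on the whole line: [s `^ alpha]
   is [1] for negative [s]. *)
Definition phase x s := x * s + t * `|s| `^ alpha.
Definition osc x A := \int[mu]_(s in `[0, A]) cos (phase x s).

Let alpha0 : 0 < alpha. Proof. exact: lt_trans alpha1. Qed.

Lemma phase_continuous x : continuous (phase x).
Proof.
move=> s; apply: (@continuousD _ _ _ (fun s => x * s) (fun s => t * `|s| `^ alpha)).
  apply: (@continuousM _ _ (fun=> x) id); first exact: cst_continuous.
  exact: cvg_id.
apply: (@continuousM _ _ (fun=> t) (fun s : R => `|s| `^ alpha)).
  exact: cst_continuous.
exact: abs_powR_continuous.
Qed.

Lemma cos_phase_continuous x : continuous (fun s => cos (phase x s)).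
Proof.
move=> s; apply: (@continuous_comp _ _ _ (phase x) cos); first exact: phase_continuous.
exact: continuous_cos.
Qed.

Lemma osc_is_derive x s : 0 < s -> is_derive s (1 : R) (osc x) (cos (x * s + t * s `^ alpha)).
Proof.
move=> s0; have ss : s < s + 1 by lra.
have [d dE] := continuous_FTC1_closed ss (itv_integrable 0 (s + 1) (@cos_phase_continuous x))
  s0 (@cos_phase_continuous x s).
apply: DeriveDef => //.
by rewrite -derive1E [LHS]dE /phase gtr0_norm.
Qed.

Let speed x s := x + t * alpha * s `^ (alpha - 1).

Let phase_is_derive x s : 0 < s ->
  is_derive s (1 : R) (fun s => x * s + t * s `^ alpha) (speed x s).
Proof.
move=> s0; have := derD (der_affine s x 0) (derZ t (is_derive1_powR alpha s0)).
move=> dp; apply: (@der_ext _ (fun s => x * s + 0 + t * s `^ alpha)).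
  by move=> y; rewrite addr0.
by apply: is_derive_eq dp _; rewrite mulrA.
Qed.

Let speed_is_derive x s : 0 < s ->
  is_derive s (1 : R) (speed x) (t * alpha * ((alpha - 1) * s `^ (alpha - 1 - 1))).
Proof.
move=> s0; apply: is_derive_eq (derD (der_cst s x) (derZ (t * alpha) (is_derive1_powR (alpha - 1) s0))) _.
by rewrite add0r.
Qed.

Let speed_mono x a b : 0 < a -> a <= b -> speed x a <= speed x b.
Proof.
move=> a0 ab; rewrite lerD2l ler_pM2l ?mulr_gt0 //.
apply: ge0_ler_powR => //; rewrite ?nnegrE ?subr_ge0 ?(ltW alpha1) ?(ltW a0) //.
by apply: le_trans ab; exact: ltW.
Qed.

(* First derivative test (van der Corput): (sin phase - sg) / phase' differs
   from an antiderivative of cos phase by a monotone function. *)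
Lemma osc_increment x a b l : 0 < a -> a <= b -> 0 < l ->
  l <= x + t * alpha * a `^ (alpha - 1) -> `|osc x b - osc x a| <= 2 / l.
Proof.
move=> a0; rewrite le_eqVlt => /predU1P[<- l0 _|ab l0 la].
  by rewrite subrr normr0 divr_ge0 // ltW.
have sp s : a <= s -> 0 < speed x s.
  by move=> sa; apply: lt_le_trans (speed_mono x a0 sa); exact: lt_le_trans la.
(* Taking [sg = 1] and [sg = -1] bounds the absolute value. As [sg * (sg - sin) >= 0] and the speed
   increases, [sg * (G - osc x)] is nondecreasing; the boundary term at [b] has a favourable sign
   and the one at [a] costs at most [2 / l]. *)
have bnd sg : sg ^+ 2 = 1 -> sg * (osc x b - osc x a) <= 2 / l.
  move=> sg2; pose G s := (sin (x * s + t * s `^ alpha) - sg) * (speed x s)^-1.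
  have sgs y : -1 <= sg * sin y <= 1.
    rewrite -ler_norml normrM (_ : `|sg| = 1) ?mul1r ?sin_max //.
    by apply/eqP; rewrite -(@eqrXn2 _ 2) // expr1n real_normK ?num_real // sg2.
  pose d s := t * alpha * ((alpha - 1) * s `^ (alpha - 1 - 1)).
  pose D' s := (sg - sin (x * s + t * s `^ alpha)) * (d s / speed x s ^+ 2).
  have dD s : a <= s -> is_derive s (1 : R) (fun s => G s - osc x s) (D' s).
    move=> sa; have s0 : 0 < s by exact: lt_le_trans sa.
    have v0 := sp s sa.
    have := derB (derM (derB (der_sin (phase_is_derive x s0)) (der_cst s sg))
      (derV (lt0r_neq0 v0) (speed_is_derive x s0))) (osc_is_derive x s0).
    by move=> dG; apply: is_derive_eq dG _; rewrite /D' -/(d s); field; rewrite gt_eqF.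
  have [||c] := @MVT R (fun s => G s - osc x s) D' a b ab.
  - by move=> s; rewrite in_itv /= => /andP[/ltW sa _]; exact: dD.
  - apply: derivable_within_continuous => s; rewrite in_itv /= => /andP[sa _].
    by case: (dD s sa).
  rewrite in_itv /= => /andP[ac _] E.
  have d0 : 0 <= d c by rewrite /d !mulr_ge0 ?powR_ge0 ?subr_ge0 // ltW.
  have K : 0 <= sg * ((G b - osc x b) - (G a - osc x a)).
    rewrite E /D' 2!mulrA; apply: mulr_ge0; last by rewrite subr_ge0 ltW.
    apply: mulr_ge0; last exact: divr_ge0 d0 (sqr_ge0 _).
    rewrite mulrBr -expr2 sg2 subr_ge0.
    by case/andP: (sgs (x * c + t * c `^ alpha)).
  have Gb : sg * G b <= 0.
    rewrite /G mulrA pmulr_lle0 ?invr_gt0 ?sp ?(ltW ab) //.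
    by rewrite mulrBr -expr2 sg2 subr_le0; case/andP: (sgs (x * b + t * b `^ alpha)).
  have Ga : - (sg * G a) <= 2 / l.
    apply: le_trans (_ : 2 / speed x a <= _); last first.
      by rewrite ler_pM2l // lef_pV2 // posrE sp.
    rewrite /G mulrA -mulNr ler_pM2r ?invr_gt0 ?sp //.
    by rewrite mulrBr -expr2 sg2; have := sgs (x * a + t * a `^ alpha); lra.
  by move: K Gb Ga; rewrite !mulrBr; lra.
rewrite ler_norml -(mul1r (osc x b - _)) bnd ?expr1n // andbT.
by have := bnd (-1); rewrite sqrrN expr1n => /(_ erefl); lra.
Qed.

(* The abscissa beyond which the phase derivative exceeds [1 + r] is taken as a
   natural power of [1 + r], so that it grows polynomially in [x]. *)
Lemma speed_lower_bound : exists M : R, exists k : nat, 1 <= M /\ forall r : R, 0 <= r -> 1 + r <= t * alpha * ((M * (1 + r)) ^+ k) `^ (alpha - 1).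
Proof.
have ta : 0 < t * alpha by exact: mulr_gt0.
(* Here [k (alpha - 1) >= 1], so raising a base at least 1 to that power does not decrease it, and
   [t alpha M >= 1] absorbs the leading coefficient. *)
pose M := 1 + (t * alpha)^-1; pose k := (Num.truncn (alpha - 1)^-1).+1.
have M1 : 1 <= M by rewrite lerDl invr_ge0 ltW.
exists M, k; split=> // r r0.
have k1 : 1 <= k%:R * (alpha - 1).
  by rewrite -ler_pdivrMr ?subr_gt0 // div1r ltW // truncnS_gt.
have B1 : 1 <= M * (1 + r) by rewrite mulr_ege1 //; lra.
apply: le_trans (_ : t * alpha * (M * (1 + r)) <= _); last first.
  rewrite ler_pM2l // -powR_mulrn; last exact: le_trans B1.
  by rewrite -powRrM le1r_powR.
rewrite mulrA ler_peMl //; first by lra.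
by rewrite /M mulrDr mulr1 mulfV ?gt_eqF // lerDr ltW.
Qed.

(** Up to [s0 = (M (1 + |x|))^k] the integral is at most the length of the interval; beyond, the
    phase derivative is at least 1 and the first derivative test adds at most 2, whatever [A] is. *)
Lemma osc_bound : exists C : R, exists k : nat, 0 <= C /\ forall x A, 0 <= A -> `|osc x A| <= C * (1 + `|x|) ^+ k.
Proof.
have [M [k [M1 hM]]] := speed_lower_bound.
exists (M ^+ k + 2), k; split=> [|x A A0].
  by rewrite addr_ge0 // exprn_ge0 // (le_trans _ M1).
pose s0 := (M * (1 + `|x|)) ^+ k.
have x1 : 1 <= (1 + `|x|) ^+ k by rewrite exprn_ege1 // lerDl.
have trivial B : 0 <= B -> `|osc x B| <= B.
  move=> B0; have ic := itv_integrable 0 B (@cos_phase_continuous x).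
  apply: le_trans (le_normr_Rintegral _ ic) _ => //.
  have E1 : \int[mu]_(s in `[0, B]) (1 : R) = B.
    rewrite Rintegral_cst // mul1r /=.
    rewrite lebesgue_measure_itv /= lte_fin.
    by move: B0; rewrite le_eqVlt => /predU1P[<-|->]; rewrite ?ltxx //= subr0.
  rewrite -[leRHS]E1; apply: le_Rintegral => //.
  - exact: (integrable_norm ic).
  - by apply: itv_integrable; exact: cst_continuous.
  - by move=> s _; exact: cos_max.
have s00 : 0 < s0 by rewrite exprn_gt0 // mulr_gt0 ?(lt_le_trans _ M1) // ltr_wpDr.
have E : (M ^+ k + 2) * (1 + `|x|) ^+ k = s0 + 2 * (1 + `|x|) ^+ k.
  by rewrite mulrDl -exprMn.
have [As0|s0A] := leP A s0.
  apply: le_trans (trivial A A0) _; rewrite E; lra.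
have := @osc_increment x s0 A 1 s00 (ltW s0A) ltr01.
have := hM `|x| (normr_ge0 x); rewrite -/s0 => h1.
have h2 : - `|x| <= x by rewrite lerNnormlW.
move=> /(_ _) h3.
have {}h3 : `|osc x A - osc x s0| <= 2 / 1 by apply: h3; lra.
have := trivial s0 (ltW s00); have := ler_normD (osc x A - osc x s0) (osc x s0).
rewrite subrK E; lra.
Qed.

Lemma osc_cvg x : cvg (osc x A @[A --> +oo]).
Proof.
have [M [k [M1 hM]]] := speed_lower_bound.
apply: cauchy_cvg; apply: cauchy_exP => e e0.
(* Beyond [a] the phase derivative is at least [l], so [osc x] moves by at most [2 / l = e / 2]: the
   Cauchy criterion. *)
pose l := 4 / e; have l0 : 0 < l by rewrite divr_gt0.
pose a := (M * (1 + (`|x| + l))) ^+ k.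
have a0 : 0 < a.
  by rewrite exprn_gt0 // mulr_gt0 ?(lt_le_trans _ M1) // ltr_wpDr // addr_ge0 // ltW.
exists (osc x a); apply: filterS (nbhs_pinfty_ge (num_real a)) => A aA.
rewrite /ball /= distrC; apply: le_lt_trans (_ : _ <= 2 / l) _; last first.
  by rewrite /l invf_div mulrA ltr_pdivrMr // mulrC; lra.
apply: osc_increment => //.
have := hM (`|x| + l); rewrite -/a => /(_ (addr_ge0 (normr_ge0 x) (ltW l0))).
have h2 : - `|x| <= x by rewrite lerNnormlW.
by lra.
Qed.

End oscillatory_integral.

(** * The Airy kernel paired with cosine transforms *)

Section airy_kernel.
Context {R : realType}.
Notation mu := (@lebesgue_measure R).
Variables (alpha t : R).
Hypotheses (alpha1 : 1 < alpha) (t0 : 0 < t).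
Implicit Types (f g h : R -> R) (a b c d e x y z s A : R).

Let alpha0 : 0 < alpha. Proof. exact: lt_trans alpha1. Qed.

Lemma airy_partialE x A : airy_partial alpha x A = osc alpha alpha^-1 x A.
Proof.
apply: eq_Rintegral => s; rewrite inE /= in_itv /= => /andP[s0 _].
by rewrite /phase ger0_norm // [alpha^-1 * _]mulrC.
Qed.

(** Under [s -> c s] the term [s^alpha / alpha] becomes [c^alpha s^alpha / alpha = t s^alpha], while
    [x / c] turns back into [x]. *)
Lemma osc_scale c x A : 0 < c -> c `^ alpha = alpha * t -> 0 <= A ->
  osc alpha alpha^-1 (x / c) (c * A) = c * osc alpha t x A.
Proof.
move=> c0 cE A0; pose F y := c * y + 0.
have dF y : is_derive y (1 : R) F c by exact: der_affine.
have cF : continuous F by move=> y; exact: der_continuous (dF y).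
have F'E : derive1 F = cst c by apply/funext => y; rewrite (der_derive1 (dF y)).
have cG := @cos_phase_continuous R alpha alpha^-1 alpha1 (x / c).
pose G s := cos (phase alpha alpha^-1 (x / c) s).
have E : (\int[mu]_(s in `[F 0%R, F A]) (G s)%:E =
    \int[mu]_(s in `[0%R, A]) (((G \o F) * cst c) s)%:E)%E.
  rewrite -F'E; apply: integration_by_substitution_increasing; rewrite ?F'E //.
- by move=> y z _ _ yz; rewrite /F ltrD2r ltr_pM2l.
- by move=> y _; exact: cvg_cst.
- exact: is_cvg_cst.
- exact: is_cvg_cst.
- split; first by move=> y _; case: (dF y).
    exact/cvg_at_right_filter/cF.
  exact/cvg_at_left_filter/cF.
- exact: continuous_subspaceT.
rewrite {1}/osc /Rintegral -/(G _).
move: E; rewrite /F mulr0 !addr0 => ->.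
have ic := itv_integrable 0 A (@cos_phase_continuous R alpha t alpha1 x).
rewrite -RintegralZl //; congr fine; apply: eq_integral => s _; congr EFin.
rewrite /= [LHS]mulrC; congr (c * cos _).
rewrite /phase addr0 mulrA divfK ?gt_eqF // normrM (gtr0_norm c0) powRM ?(ltW c0) //.
by rewrite cE !mulrA mulVf ?mul1r ?gt_eqF.
Qed.

(** The prefactor of [u_airy] cancels the Jacobian of the scaling, so time survives only in the
    phase [x s + t s^alpha], where the Fourier multiplier can be recognised. *)
Lemma u_airyE x : u_airy alpha x t = pi^-1 * lim (osc alpha t x A @[A --> +oo]).
Proof.
rewrite /u_airy /airy; set c := (alpha * t) `^ alpha^-1.
have c0 : 0 < c by rewrite powR_gt0 // mulr_gt0.
have cE : c `^ alpha = alpha * t.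
  by rewrite /c -powRrM mulVf ?gt_eqF // powRr1 // mulr_ge0 // ltW.
have -> : airy_partial alpha (x / c) = osc alpha alpha^-1 (x / c).
  by apply/funext => A; rewrite airy_partialE.
have iv : 0 < alpha^-1 by rewrite invr_gt0.
have c1 := @osc_cvg R alpha alpha^-1 alpha1 iv (x / c).
have c2 := @osc_cvg R alpha t alpha1 t0 x.
have cy : c * A @[A --> +oo] --> +oo.
  apply/cvgryPge => B; apply: filterS (nbhs_pinfty_ge (num_real (B / c))) => A.
  by rewrite ler_pdivrMr // mulrC.
have E : lim (osc alpha alpha^-1 (x / c) A @[A --> +oo]) =
    c * lim (osc alpha t x A @[A --> +oo]).
  have h1 : c * osc alpha t x A @[A --> +oo] --> lim (osc alpha alpha^-1 (x / c) A @[A --> +oo]).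
    have h0 : osc alpha alpha^-1 (x / c) (c * A) @[A --> +oo] -->
        lim (osc alpha alpha^-1 (x / c) A @[A --> +oo]).
      exact: (@cvg_comp _ _ _ (fun A => c * A) (osc alpha alpha^-1 (x / c)) _ _ _ cy c1).
    apply: cvg_trans h0; apply: near_eq_cvg.
    apply: filterS (nbhs_pinfty_ge (num_real 0)) => A A0 /=.
    by rewrite osc_scale.
  have h2 : c * osc alpha t x A @[A --> +oo] --> c * lim (osc alpha t x A @[A --> +oo]).
    by apply: cvgM; [exact: cvg_cst|exact: c2].
  by rewrite -(cvg_lim _ h1) // (cvg_lim _ h2).
by rewrite E mulrCA mulKf ?gt_eqF.
Qed.

Lemma u_airy_cvg x : pi^-1 * osc alpha t x n%:R @[n --> \oo] --> u_airy alpha x t.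
Proof.
rewrite u_airyE; apply: cvgM; first exact: cvg_cst.
exact: (@cvg_comp _ _ _ (fun n : nat => n%:R) (osc alpha t x) _ _ _ cvgr_idn (@osc_cvg R alpha t alpha1 t0 x)).
Qed.

(** Turns a truncated integral into one over the line with an integrable weight, the form in which
    [rint_fubini] applies. *)
Let box (n : nat) : R -> R := \1_(`[0, n%:R]%classic).

Let box_L1 n : L1 (box n).
Proof. exact: integrable_indic_itv. Qed.

Let osc_box n x : osc alpha t x n%:R = rint (fun s => box n s * cos (phase alpha t x s)).
Proof.
rewrite /osc Rintegral_mkcond; apply: rint_ext => s.
by rewrite patchE /box indicE; case: ifP => _; rewrite ?mul1r ?mul0r.
Qed.

Let phase_measurable : measurable_fun setT (fun z : R * R => cos (phase alpha t z.1 z.2)).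
Proof.
apply: (measurableT_comp (continuous_measurable_fun (@continuous_cos R))).
apply: measurable_funD.
  by apply: measurable_funM; [exact: measurable_fst|exact: measurable_snd].
apply: measurable_funM; first exact: measurable_cst.
apply: (measurableT_comp (continuous_measurable_fun (abs_powR_continuous alpha0))).
exact: measurable_snd.
Qed.

(** The addition formula writes the function as a difference of a cosine and a sine transform of
    functions supported in [[0, n]]; both are differentiable in [x], hence continuous. *)
Lemma osc_measurable n : measurable_fun setT (fun x => osc alpha t x n%:R).
Proof.
pose h k s := k (t * `|s| `^ alpha) * box n s.
have lh k : continuous k -> (forall y, `|k y| <= 1) -> L1 (h k) /\ L1 (fun s => s * h k s).
  move=> ck k1.
  have mk : measurable_fun setT (fun s : R => k (t * `|s| `^ alpha)).
    apply: continuous_measurable_fun => s.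
    apply: (@continuous_comp _ _ _ (fun s : R => t * `|s| `^ alpha)); last exact: ck.
    apply: (@continuousM _ _ (fun=> t) (fun s : R => `|s| `^ alpha)); first exact: cst_continuous.
    exact: abs_powR_continuous.
  have l : L1 (h k) by exact: (L1_mul_bounded mk).
  split=> //; apply: (L1_le _ (L1Z n%:R (box_L1 n))).
    by apply: measurable_funM => //; exact: L1_measurable l.
  move=> s; rewrite /h /box indicE !normrM.
  case: (boolP (s \in _)) => [|_]; last by rewrite !normr0 !mulr0.
  rewrite inE /= in_itv /= => /andP[s0 sn]; rewrite !normr1 !mulr1 ger0_norm //.
  by rewrite -[leRHS]mulr1 ler_pM.
have [lc lxc] := lh _ (@continuous_cos R) (@cos_max R).
have [ls lxs] := lh _ (@continuous_sin R) (@sin_max R).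
have E x : osc alpha t x n%:R = costr 0 (h cos) x - costr (- (pi / 2)) (h sin) x.
  rewrite osc_box /costr -rintB; [|exact: cos_L1..].
  by apply: rint_ext => s; rewrite /h /phase addr0 cosD cosBpihalf; ring.
rewrite (funext E); apply: measurable_funB.
  by apply: continuous_measurable_fun; exact: costr_continuous.
by apply: continuous_measurable_fun; exact: costr_continuous.
Qed.

Lemma u_airy_measurable : measurable_fun setT (u_airy alpha ^~ t).
Proof.
apply: (@measurable_fun_cvg _ _ R setT (fun n x => pi^-1 * osc alpha t x n%:R)).
  by move=> n; apply: measurable_funM => //; exact: osc_measurable.
by move=> x _; exact: u_airy_cvg.
Qed.

Lemma u_airy_bound : exists C : R, exists k : nat, 0 <= C /\
  forall x, (forall n : nat, `|pi^-1 * osc alpha t x n%:R| <= C * (1 + `|x|) ^+ k) /\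
    `|u_airy alpha x t| <= C * (1 + `|x|) ^+ k.
Proof.
have [C [k [C0 hC]]] := @osc_bound R alpha t alpha1 t0.
have ip : 0 <= (pi^-1 : R) by rewrite invr_ge0 pi_ge0.
exists (pi^-1 * C), k; split=> [|x]; first exact: mulr_ge0.
have bn (n : nat) : `|pi^-1 * osc alpha t x n%:R| <= pi^-1 * C * (1 + `|x|) ^+ k.
  by rewrite normrM (ger0_norm ip) -mulrA ler_wpM2l // hC.
split=> //.
have cn : `|pi^-1 * osc alpha t x n%:R| @[n --> \oo] --> `|u_airy alpha x t|.
  by apply: cvg_norm; exact: u_airy_cvg.
rewrite -(cvg_lim _ cn) //; apply: limr_le; first exact: cvgP cn.
exact: nearW.
Qed.

(* t sgn(s) |s|^alpha, in a form that is visibly continuous *)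
Definition odd_phase s := t * (s * `|s| `^ (alpha - 1)).

Lemma odd_phaseN s : odd_phase (- s) = - odd_phase s.
Proof. by rewrite /odd_phase normrN mulNr mulrN. Qed.

Lemma odd_phase_ge0 s : 0 <= s -> odd_phase s = t * `|s| `^ alpha.
Proof. by move=> s0; rewrite /odd_phase ger0_norm // mulr_powRB1. Qed.

Lemma odd_phase_continuous : continuous odd_phase.
Proof.
move=> s; apply: (@continuousM _ _ (fun=> t) (fun s : R => s * `|s| `^ (alpha - 1))).
  exact: cst_continuous.
apply: (@continuousM _ _ id (fun s : R => `|s| `^ (alpha - 1))); first exact: cvg_id.
by apply: abs_powR_continuous; rewrite subr_gt0.
Qed.

Lemma le_expD1 (r : R) k : 0 <= r -> (1 + r) ^+ k <= 2 ^+ k * (1 + r ^+ k).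
Proof.
move=> r0; have [r1|/ltW r1] := leP r 1.
  apply: le_trans (_ : 2 ^+ k <= _); first by apply: lerXn2r; rewrite ?nnegrE; lra.
  by rewrite ler_peMr ?exprn_ge0 // lerDl exprn_ge0.
apply: le_trans (_ : (2 * r) ^+ k <= _); first by apply: lerXn2r; rewrite ?nnegrE; lra.
by rewrite exprMn ler_wpM2l ?exprn_ge0 // lerDr.
Qed.

(** The two extra powers pay for the factor [1 + x^2], which is at most [(1 + |x|)^2]. Keeping [S0]
    and [S1] explicit lets the same estimate give integrability here and, with seminorms for bounds,
    temperedness later. *)
Lemma poly_growth_bound C k f S0 S1 x : 0 <= C ->
  `|f x| <= S0 -> `|x| ^+ k.+2 * `|f x| <= S1 ->
  C * (1 + `|x|) ^+ k * `|f x| <= C * 2 ^+ k.+2 * (S0 + S1) * (1 + x ^+ 2)^-1.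
Proof.
move=> C0 h0 h1; rewrite ler_pdivlMr ?ltr_wpDr ?sqr_ge0 //.
rewrite -[leRHS](mulrA C) -[leLHS]mulrA -[leLHS](mulrA C) ler_wpM2l //.
apply: (@le_trans _ _ ((1 + `|x|) ^+ k.+2 * `|f x|)).
  rewrite -(addn2 k) exprD -mulrA ler_wpM2l ?exprn_ge0 // ?addr_ge0 // mulrC.
  rewrite ler_wpM2r // -(real_normK (num_real x)).
  have := normr_ge0 x; move: `|x| => r r0; nra.
apply: (@le_trans _ _ (2 ^+ k.+2 * (1 + `|x| ^+ k.+2) * `|f x|)).
  by rewrite ler_wpM2r // le_expD1.
by rewrite -[leLHS](mulrA (2 ^+ k.+2)) ler_wpM2l ?exprn_ge0 // mulrDl mul1r lerD.
Qed.

Lemma poly_rschwartz_L1 C k f : 0 <= C -> rschwartz f ->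
  L1 (fun x => C * (1 + `|x|) ^+ k * `|f x|).
Proof.
move=> C0 sf; have [S0 h0] := rschwartz_bound 0 sf.
have [S1 h1] := rschwartz_bound k.+2 sf.
apply: (L1_le _ (L1Z (C * 2 ^+ k.+2 * (S0 + S1)) (proj1 (@L1_oneDsqrV R)))).
  apply: measurable_funM; last first.
    by apply: measurableT_comp => //; exact: rschwartz_measurable.
  apply: measurable_funM => //; apply: measurable_funX; apply: measurable_funD => //.
move=> x; rewrite ger0_norm; last by rewrite !mulr_ge0 ?exprn_ge0 ?addr_ge0.
by apply: poly_growth_bound => //; have := h0 x; rewrite expr0 mul1r.
Qed.

Theorem u_airy_pairing b f : rschwartz f ->
  rint (fun x => u_airy alpha x t * costr b f x) =
  rint (fun s => cos (odd_phase s - b) * f s).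
Proof.
move=> sf; have sg := rschwartz_costr b sf; have lg := rschwartz_L1 sg.
have [C [k [C0 hC]]] := u_airy_bound.
have c1 : rint (fun x => (pi^-1 * osc alpha t x n%:R) * costr b f x) @[n --> \oo] -->
    rint (fun x => u_airy alpha x t * costr b f x).
  apply: (rint_dominated_cvg _ _ (poly_rschwartz_L1 k C0 sg) _).2.
  - move=> n; apply: measurable_funM; last exact: (L1_measurable lg).
    by apply: measurable_funM => //; exact: osc_measurable.
  - by move=> x; apply: cvgM; [exact: u_airy_cvg|exact: cvg_cst].
  - by move=> n x; rewrite normrM ler_wpM2r //; case: (hC x).
pose h s := cos (odd_phase s - b) * f s.
have lh : L1 h.
  apply: (@L1_mul_bounded _ 1); last exact: rschwartz_L1.
    apply: continuous_measurable_fun => s.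
    apply: (@continuous_comp _ _ _ (fun s => odd_phase s - b) cos); last exact: continuous_cos.
    by apply: (@continuousB _ _ _ odd_phase (fun=> b)); [exact: odd_phase_continuous|exact: cst_continuous].
  by move=> s; exact: cos_max.
have ch : continuous h.
  move=> s; apply: (@continuousM _ _ (fun s => cos (odd_phase s - b)) f); last exact: rschwartz_continuous.
  apply: (@continuous_comp _ _ _ (fun s => odd_phase s - b) cos); last exact: continuous_cos.
  by apply: (@continuousB _ _ _ odd_phase (fun=> b)); [exact: odd_phase_continuous|exact: cst_continuous].
have E n : rint (fun x => (pi^-1 * osc alpha t x n%:R) * costr b f x) =
    \int[mu]_(s in `[0, n%:R]) (h s + h (- s)).
  have pi0 : (pi : R) != 0 by rewrite gt_eqF // pi_gt0.
  transitivity (pi^-1 * rint (fun x => costr b f x *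
      rint (fun s => box n s * cos (phase alpha t x s)))).
    rewrite -rintZ; last first.
      apply: (@L1_le _ _ (fun x => pi * (C * (1 + `|x|) ^+ k * `|costr b f x|))).
      - apply: measurable_funM; first exact: (L1_measurable lg).
        by under eq_fun do rewrite -osc_box; exact: osc_measurable.
      - exact/L1Z/poly_rschwartz_L1.
      move=> x; rewrite -osc_box normrM mulrC mulrA ler_wpM2r //.
      have := (hC x).1 n; rewrite normrM ger0_norm ?invr_ge0 ?pi_ge0 //.
      by rewrite mulrC ler_pdivrMr ?pi_gt0 // mulrC.
    by apply: rint_ext => x; rewrite -osc_box; ring.
  rewrite rint_fubini //; last by move=> x s; exact: cos_max.
  transitivity (pi^-1 * rint (fun s => box n s * (pi * (h s + h (- s))))).
    congr (_ * _); apply: rint_ext => s; rewrite /box indicE.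
    case: (boolP (s \in _)) => [|_]; last by rewrite !mul0r.
    rewrite inE /= in_itv /= => /andP[s0 _]; rewrite !mul1r.
    (* With [s] fixed, [t |s|^alpha] is a constant shift, so inversion applies. Since [odd_phase] is
       odd and equals this shift for [s >= 0], the terms at [s] and [- s] are [h s] and
       [h (- s)]. *)
    transitivity (costr (t * `|s| `^ alpha) (costr b f) s).
      by apply: rint_ext => x; rewrite mulrC /phase (mulrC x).
    rewrite costr_inversion // /h odd_phaseN odd_phase_ge0 //.
    rewrite [in RHS]addrC; congr (_ * (_ * _ + _)).
    by rewrite -[RHS]cosN opprB opprK addrC.
  have -> : rint (fun s => box n s * (pi * (h s + h (- s)))) =
      \int[mu]_(s in `[0, n%:R]) (pi * (h s + h (- s))).
    rewrite [RHS]Rintegral_mkcond; apply: rint_ext => s.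
    by rewrite patchE /box indicE; case: ifP => _; rewrite ?mul1r ?mul0r.
  rewrite RintegralZl ?mulKf //; apply: itv_integrable => s.
  apply: (@continuousD _ _ _ h (fun s => h (- s))); first exact: ch.
  by apply: (@continuous_comp _ _ _ -%R h); [exact: opp_continuous|exact: ch].
have c2 := rint_cvg_fold lh ch.
have c1' : \int[mu]_(s in `[0, n%:R]) (h s + h (- s)) @[n --> \oo] -->
    rint (fun x => u_airy alpha x t * costr b f x).
  by apply: cvg_trans c1; apply: near_eq_cvg; apply: nearW => n; rewrite E.
by rewrite -(cvg_lim _ c1') // (cvg_lim _ c2).
Qed.

End airy_kernel.

(** * Complex Schwartz functions and surjectivity of the Fourier transform *)

Section complex_fourier.
Context {R : realType}.
Notation mu := (@lebesgue_measure R).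
Implicit Types (f g h : R -> R) (a b c d e x y s : R) (z w : R[i]) (phi psi : R -> R[i]).

Local Notation Re := (@complex.Re R).
Local Notation Im := (@complex.Im R).

Lemma cmod_Re z : `|Re z| <= cmod z.
Proof.
by case: z => a b; rewrite /cmod /= -sqrtr_sqr ler_wsqrtr // lerDl sqr_ge0.
Qed.

Lemma cmod_Im z : `|Im z| <= cmod z.
Proof.
by case: z => a b; rewrite /cmod /= -sqrtr_sqr ler_wsqrtr // lerDr sqr_ge0.
Qed.

Lemma cmod_le z : cmod z <= `|Re z| + `|Im z|.
Proof.
case: z => a b; rewrite /cmod /=.
rewrite -[leRHS]ger0_norm ?addr_ge0 // -sqrtr_sqr ler_wsqrtr //.
rewrite sqrrD !real_normK ?num_real // lerD2r lerDl.
by rewrite mulrn_wge0 // mulr_ge0.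
Qed.

Lemma cmod_ge0 z : 0 <= cmod z.
Proof. exact: le_trans (normr_ge0 _) (cmod_Re z). Qed.

Lemma complex_ext z w : Re z = Re w -> Im z = Im w -> z = w.
Proof. by case: z => a b; case: w => c d /= -> ->. Qed.

(** The modulus lies between the absolute value of either component and the sum of both, so the
    decay conditions agree. *)
Lemma schwartzP phi : schwartz phi <->
  rschwartz (fun x => Re (phi x)) /\ rschwartz (fun x => Im (phi x)).
Proof.
split=> [[d b]|[[d1 b1] [d2 b2]]].
  split; split=> [n x|m n]; try by have [] := d n x.
    have [C hC] := b m n; exists C => x; apply: le_trans (hC x).
    by rewrite ler_wpM2l ?exprn_ge0 //; exact: (cmod_Re (cderive1n n phi x)).
  have [C hC] := b m n; exists C => x; apply: le_trans (hC x).
  by rewrite ler_wpM2l ?exprn_ge0 //; exact: (cmod_Im (cderive1n n phi x)).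
split=> [n x|m n]; first by split.
have [C1 h1] := b1 m n; have [C2 h2] := b2 m n; exists (C1 + C2) => x.
apply: le_trans (lerD (h1 x) (h2 x)); rewrite -mulrDr ler_wpM2l ?exprn_ge0 //.
exact: (cmod_le (cderive1n n phi x)).
Qed.

Lemma cderive1n0 phi x : cderive1n 0 phi x = phi x.
Proof. exact: complex_ext. Qed.

(** A [sup] is an upper bound only for a bounded set; [schwartz] supplies the boundedness. *)
Lemma seminorm_ub m n phi x : schwartz phi ->
  `|x| ^+ m * cmod (cderive1n n phi x) <= schwartz_seminorm m n phi.
Proof.
move=> [_ /(_ m n)[C hC]]; apply: ub_le_sup; last by exists x.
by exists C => _ [y _ <-].
Qed.

Lemma seminorm_ge0 m n phi : schwartz phi -> 0 <= schwartz_seminorm m n phi.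
Proof.
move=> sphi; apply: le_trans (seminorm_ub m n 0 sphi).
by rewrite mulr_ge0 ?exprn_ge0 ?cmod_ge0.
Qed.

Lemma seminorm_le_sum (N i j : nat) phi : schwartz phi -> (i <= N)%N -> (j <= N)%N ->
  schwartz_seminorm i j phi <=
    \sum_(m < N.+1) \sum_(n < N.+1) schwartz_seminorm m n phi.
Proof.
move=> sphi iN jN; rewrite (bigD1 (Ordinal (iN : (i < N.+1)%N))) //=.
rewrite (bigD1 (Ordinal (jN : (j < N.+1)%N))) //= -addrA lerDl addr_ge0 //.
  by apply: sumr_ge0 => k _; exact: seminorm_ge0.
by apply: sumr_ge0 => l _; apply: sumr_ge0 => k _; exact: seminorm_ge0.
Qed.

Lemma Re_mulc z w : Re (z * w) = Re z * Re w - Im z * Im w.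
Proof. by case: z => a b; case: w. Qed.

Lemma Im_mulc z w : Im (z * w) = Re z * Im w + Im z * Re w.
Proof. by case: z => a b; case: w. Qed.

Lemma Re_addc z w : Re (z + w) = Re z + Re w.
Proof. by case: z => a b; case: w. Qed.

Lemma Im_addc z w : Im (z + w) = Im z + Im w.
Proof. by case: z => a b; case: w. Qed.

Lemma cintegrable_lin z phi psi : cintegrable phi -> cintegrable psi ->
  cintegral (fun x => z * phi x + psi x) = z * cintegral phi + cintegral psi.
Proof.
move=> [i1 i2] [j1 j2]; apply: complex_ext.
  rewrite Re_addc Re_mulc /= -!rintZ // -rintB; [|exact: L1Z..].
  rewrite -rintD //; last by apply: L1B; exact: L1Z.
  by apply: rint_ext => x; rewrite Re_addc Re_mulc.
rewrite Im_addc Im_mulc /= -!rintZ // -rintD; [|exact: L1Z..].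
rewrite -rintD //; last by apply: L1D; exact: L1Z.
by apply: rint_ext => x; rewrite Im_addc Im_mulc.
Qed.

Lemma fourierE phi y : schwartz phi -> fourier phi y =
  (costr 0 (fun x => Re (phi x)) y - costr (- (pi / 2)) (fun x => Im (phi x)) y) +i*
  (costr 0 (fun x => Im (phi x)) y + costr (- (pi / 2)) (fun x => Re (phi x)) y).
Proof.
move=> /schwartzP[/rschwartz_L1 l1 /rschwartz_L1 l2].
apply: complex_ext; rewrite /= /costr.
  rewrite -rintB; [|exact: cos_L1..].
  by apply: rint_ext => x; rewrite Re_mulc /= addr0 cosBpihalf.
rewrite -rintD; [|exact: cos_L1..].
by apply: rint_ext => x; rewrite Im_mulc /= addr0 cosBpihalf.
Qed.

Lemma costr_lin b c d f g y : L1 f -> L1 g ->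
  costr b (fun x => c * f x + d * g x) y = c * costr b f y + d * costr b g y.
Proof.
move=> lf lg; rewrite /costr -!rintZ; [|exact: cos_L1..].
rewrite -rintD; [|exact/L1Z/cos_L1..].
by apply: rint_ext => x; ring.
Qed.

Lemma fourier_surjective psi : schwartz psi -> exists2 phi, schwartz phi & fourier phi = psi.
Proof.
move=> /schwartzP[]; set f := fun x => Re _; set g := fun x => Im _ => sf sg.
pose C := @costr R 0; pose S := @costr R (- (pi / 2)).
have sC h : rschwartz h -> rschwartz (C h) by exact: rschwartz_costr.
have sS h : rschwartz h -> rschwartz (S h) by exact: rschwartz_costr.
(* [phi] is the inverse transform, with kernel [exp (- i x y) / (2 pi)], split into components.
   Inversion makes [C C + S S] equal to [2 pi] times the identity and kills the mixed terms, which
   explains [k] and the signs. *)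
pose k : R := (2 * pi)^-1.
pose phi x : R[i] := (k * C f x + k * S g x) +i* (k * C g x + (- k) * S f x).
have sphi : schwartz phi.
  apply/schwartzP; split; first exact: (rschwartz_lin k k (sC f sf) (sS g sg)).
  exact: (rschwartz_lin k (- k) (sC g sg) (sS f sf)).
exists phi => //; apply/funext => y.
have lC h : rschwartz h -> L1 (C h) by move=> /sC/rschwartz_L1.
have lS h : rschwartz h -> L1 (S h) by move=> /sS/rschwartz_L1.
have CC h : rschwartz h -> C (C h) y = pi * (h (- y) + h y).
  by move=> sh; rewrite /C costr_inversion // addr0 subr0 cos0 !mul1r.
have SS h : rschwartz h -> S (S h) y = pi * (h y - h (- y)).
  move=> sh; rewrite /S costr_inversion // subrr cos0 -opprD cosN.
  by rewrite -splitr cospi; ring.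
have CS h : rschwartz h -> C (S h) y = 0.
  move=> sh; rewrite /C /S costr_inversion // add0r sub0r opprK cosN cos_pihalf; ring.
have SC h : rschwartz h -> S (C h) y = 0.
  move=> sh; rewrite /C /S costr_inversion // addr0 subr0 cosN cos_pihalf; ring.
have pi0 : (pi : R) != 0 by rewrite gt_eqF // pi_gt0.
have E b : costr b (fun x => Re (phi x)) y = k * costr b (C f) y + k * costr b (S g) y.
  exact: (costr_lin b k k y (lC f sf) (lS g sg)).
have F b : costr b (fun x => Im (phi x)) y = k * costr b (C g) y + (- k) * costr b (S f) y.
  exact: (costr_lin b k (- k) y (lC g sg) (lS f sf)).
rewrite fourierE // !E !F -/C -/S; apply: complex_ext; rewrite [LHS]/=.
  rewrite (CC f sf) (CS g sg) (SC g sg) (SS f sf) -/(f y) /k.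
  by move: (@pi R) pi0 => q q0; field.
rewrite (CC g sg) (CS f sf) (SC f sf) (SS g sg) -/(g y) /k.
by move: (@pi R) pi0 => q q0; field.
Qed.

End complex_fourier.

(** * The transformed Cauchy problem and its solution *)

Section cauchy_problem.
Context {R : realType}.
Notation mu := (@lebesgue_measure R).
Variables (alpha : R) (alpha1 : 1 < alpha).
Implicit Types (f g h : R -> R) (a b c d e x y s t : R) (z w : R[i]) (phi psi : R -> R[i]).

Local Notation Re := (@complex.Re R).
Local Notation Im := (@complex.Im R).

(** The real symbol [sgn(y) |y|^alpha]: the angular velocity at which the transformed equation
    rotates the frequency [y]. *)
Definition freq y : R := y * `|y| `^ (alpha - 1).

Lemma odd_phaseE t y : odd_phase alpha t y = freq y * t.
Proof. exact: mulrC. Qed.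

(** For [theta = 1] and [y] nonzero the exponential is [i sgn(y)], so the multiplier is
    [- i freq y]. At [y = 0] the exponential is 1, but the power of [|y|] vanishes. *)
Lemma riesz_feller_hatE (fhat : R -> R[i]) y :
  riesz_feller_hat alpha 1 fhat y =
    (freq y * Im (fhat y)) +i* (- (freq y * Re (fhat y))).
Proof.
have a0 : 0 < alpha by exact: lt_trans alpha1.
have E : `|y| * `|y| `^ (alpha - 1) = `|y| `^ alpha by rewrite mulr_powRB1.
rewrite /riesz_feller_hat /freq mulr1 -E.
case: (fhat y) => a b; apply: complex_ext; rewrite /= /expi /=.
  have [y0|y0|->] := ltrgt0P y.
  - by rewrite gtr0_sg // mulr1 cos_pihalf sin_pihalf; ring.
  - by rewrite ltr0_sg // mulrN1 cosN sinN cos_pihalf sin_pihalf; ring.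
  - by rewrite !mul0r; ring.
have [y0|y0|->] := ltrgt0P y.
- by rewrite gtr0_sg // mulr1 cos_pihalf sin_pihalf; ring.
- by rewrite ltr0_sg // mulrN1 cosN sinN cos_pihalf sin_pihalf; ring.
- by rewrite !mul0r; ring.
Qed.

(** Nothing is known about [f] at 0 beyond its right limit, so the mean value theorem is applied on
    [[s, t]] with [s > 0], and then [s] tends to 0. *)
Lemma constant_of_zero_derivative f (l : R) :
  (forall t, 0 < t -> is_derive t (1 : R) f 0) -> f t @[t --> 0^'+] --> l ->
  forall t, 0 < t -> f t = l.
Proof.
move=> df fl t t0.
have fE s : 0 < s -> s < t -> f s = f t.
  move=> s0 st; have [||c _] := @MVT R f (fun=> 0) s t st.
  - by move=> r; rewrite in_itv /= => /andP[sr _]; apply: df; exact: lt_trans sr.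
  - apply: derivable_within_continuous => r; rewrite in_itv /= => /andP[sr _].
    by case: (df r (lt_le_trans s0 sr)).
  by rewrite mul0r => /eqP; rewrite subr_eq0 => /eqP.
have ct : f s @[s --> 0^'+] --> f t.
  apply: cvg_near_cst; near=> s; apply: fE; near: s.
    exact: nbhs_right_gt.
  exact: nbhs_right_lt.
by rewrite -(cvg_lim _ ct) // (cvg_lim _ fl).
Unshelve. all: by end_near. Qed.

Lemma uhat_unique (v : R -> R[i]) y :
  (forall t, 0 < t -> is_cderive v t
     ((freq y * Im (v t)) +i* (- (freq y * Re (v t))))) ->
  v 0 = 1 -> cmod (v t - v 0) @[t --> 0^'+] --> (0 : R) ->
  forall t, 0 < t -> v t = expi (- odd_phase alpha t y).
Proof.
move=> dv v0 cv; rewrite v0 in cv.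
pose a t := Re (v t); pose b t := Im (v t); pose w := freq y.
have ca : a t @[t --> 0^'+] --> (1 : R).
  apply/subr_cvg0; apply: norm_cvg0.
  apply: (squeeze_cvgr _ (cvg_cst 0) cv); near=> s.
  rewrite normr_ge0 /=; apply: le_trans (cmod_Re _).
  by rewrite /a; case: (v s).
have cb : b t @[t --> 0^'+] --> (0 : R).
  apply: norm_cvg0; apply: (squeeze_cvgr _ (cvg_cst 0) cv); near=> s.
  rewrite normr_ge0 /=; apply: le_trans (cmod_Im _).
  by rewrite /b; case: (v s) => p q /=; rewrite subr0.
have cw : w * t @[t --> 0^'+] --> (0 : R).
  rewrite -[X in _ --> X](mulr0 w); apply: cvg_at_right_filter.
  by apply: cvgM; [exact: cvg_cst|exact: cvg_id].
have cc : cos (w * t) @[t --> 0^'+] --> (1 : R).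
  by rewrite -[X in _ --> X](@cos0 R); exact: (@cvg_comp _ _ _ _ cos _ _ _ cw (@continuous_cos R 0)).
have cs : sin (w * t) @[t --> 0^'+] --> (0 : R).
  by rewrite -[X in _ --> X](@sin0 R); exact: (@cvg_comp _ _ _ _ sin _ _ _ cw (@continuous_sin R 0)).
have dw t : is_derive t (1 : R) (fun t => w * t) w.
  by apply: is_derive_eq (derZ w (der_id t)) _; rewrite mulr1.
(* [p1] and [q0]: the real and imaginary parts of exp (i w t) v(t) are constant. *)
have p1 t : 0 < t -> a t * cos (w * t) - b t * sin (w * t) = 1.
  apply: (@constant_of_zero_derivative (fun t => a t * cos (w * t) - b t * sin (w * t))).
    move=> s /dv[/= da db].
    have := derB (derM da (der_cos (dw s))) (derM db (der_sin (dw s))).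
    by move=> dp; apply: is_derive_eq dp _; rewrite /w; ring.
  rewrite -[X in _ --> X]subr0 -[X in _ --> X - _]mulr1 -[X in _ --> _ - X](mulr0 0).
  by apply: cvgB; apply: cvgM.
have q0 t : 0 < t -> a t * sin (w * t) + b t * cos (w * t) = 0.
  apply: (@constant_of_zero_derivative (fun t => a t * sin (w * t) + b t * cos (w * t))).
    move=> s /dv[/= da db].
    have := derD (derM da (der_sin (dw s))) (derM db (der_cos (dw s))).
    by move=> dq; apply: is_derive_eq dq _; rewrite /w; ring.
  rewrite -[X in _ --> X]addr0 -[X in _ --> X + _](mulr0 1) -[X in _ --> _ + X](mul0r 1).
  by apply: cvgD; apply: cvgM.
(* The relations [p1] and [q0] say that rotating [v t] by [w t] gives 1; the inverse rotation
   recovers both components. *)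
move=> t t0; have := p1 t t0; have := q0 t t0; have := cos2Dsin2 (w * t).
rewrite odd_phaseE -/w /expi cosN sinN /a /b.
case: (v t) => p q /= K E1 E2; apply: complex_ext => /=.
  transitivity (p * (cos (w * t) ^+ 2 + sin (w * t) ^+ 2)); first by rewrite K mulr1.
  transitivity ((p * cos (w * t) - q * sin (w * t)) * cos (w * t) +
    (p * sin (w * t) + q * cos (w * t)) * sin (w * t)); first by ring.
  by rewrite E1 E2; ring.
transitivity (q * (cos (w * t) ^+ 2 + sin (w * t) ^+ 2)); first by rewrite K mulr1.
transitivity (- (p * cos (w * t) - q * sin (w * t)) * sin (w * t) +
  (p * sin (w * t) + q * cos (w * t)) * cos (w * t)); first by ring.
by rewrite E1 E2; ring.
Unshelve. all: by end_near. Qed.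

Lemma u_airy_mul_integrable t psi : 0 < t -> schwartz psi ->
  cintegrable (fun x => (u_airy alpha x t)%:C * psi x).
Proof.
move=> t0 /schwartzP[s1 s2].
have [C [k [C0 hC]]] := u_airy_bound alpha1 t0.
have L f : rschwartz f -> L1 (fun x => u_airy alpha x t * f x).
  move=> sf; apply: (L1_le _ (poly_rschwartz_L1 k C0 sf)).
    apply: measurable_funM; first exact: u_airy_measurable.
    exact: rschwartz_measurable.
  by move=> x; rewrite normrM ler_wpM2r //; case: (hC x).
have E1 : (fun x => Re ((u_airy alpha x t)%:C * psi x)) =
    (fun x => u_airy alpha x t * Re (psi x)).
  by apply/funext => x; rewrite Re_mulc /= mul0r subr0.
have E2 : (fun x => Im ((u_airy alpha x t)%:C * psi x)) =
    (fun x => u_airy alpha x t * Im (psi x)).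
  by apply/funext => x; rewrite Im_mulc /= mul0r addr0.
by split; rewrite ?E1 ?E2; exact: L.
Qed.

Lemma expi_mul_integrable t phi : schwartz phi ->
  cintegrable (fun y => expi (- odd_phase alpha t y) * phi y).
Proof.
move=> /schwartzP[/rschwartz_L1 l1 /rschwartz_L1 l2].
have mE : measurable_fun setT (odd_phase alpha t).
  by apply: continuous_measurable_fun; exact: odd_phase_continuous.
have mc : measurable_fun setT (fun y => cos (- odd_phase alpha t y)).
  apply: (measurableT_comp (continuous_measurable_fun (@continuous_cos R))).
  exact: measurableT_comp.
have ms : measurable_fun setT (fun y => sin (- odd_phase alpha t y)).
  apply: (measurableT_comp (continuous_measurable_fun (@continuous_sin R))).
  exact: measurableT_comp.
have E1 : (fun y => Re (expi (- odd_phase alpha t y) * phi y)) = (fun y =>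
    cos (- odd_phase alpha t y) * Re (phi y) - sin (- odd_phase alpha t y) * Im (phi y)).
  by apply/funext => x; rewrite Re_mulc.
have E2 : (fun y => Im (expi (- odd_phase alpha t y) * phi y)) = (fun y =>
    cos (- odd_phase alpha t y) * Im (phi y) + sin (- odd_phase alpha t y) * Re (phi y)).
  by apply/funext => x; rewrite Im_mulc.
by split; rewrite ?E1 ?E2; [apply: L1B|apply: L1D]; apply: (@L1_mul_bounded _ 1) => // x;
  rewrite ?cos_max ?sin_max.
Qed.

(** Each component combines [u_airy_pairing] at [b = 0] and [b = - (pi / 2)], where
    [cos (odd_phase - b)] is the real and the imaginary part of [exp (- i odd_phase)]
    respectively. *)
Lemma u_airy_fourier t phi : 0 < t -> schwartz phi ->
  cintegral (fun x => (u_airy alpha x t)%:C * fourier phi x) =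
  cintegral (fun y => expi (- odd_phase alpha t y) * phi y).
Proof.
move=> t0 sphi; have /schwartzP[s1 s2] := sphi.
have [C [k [C0 hC]]] := u_airy_bound alpha1 t0.
have L b f : rschwartz f -> L1 (fun x => u_airy alpha x t * costr b f x).
  move=> /(rschwartz_costr b) sf; apply: (L1_le _ (poly_rschwartz_L1 k C0 sf)).
    apply: measurable_funM; first exact: u_airy_measurable.
    exact: rschwartz_measurable.
  by move=> x; rewrite normrM ler_wpM2r //; case: (hC x).
have mE : measurable_fun setT (odd_phase alpha t).
  by apply: continuous_measurable_fun; exact: odd_phase_continuous.
have M b f : rschwartz f -> L1 (fun s => cos (odd_phase alpha t s - b) * f s).
  move=> /rschwartz_L1; apply: (@L1_mul_bounded _ 1) => [|x]; last exact: cos_max.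
  apply: (measurableT_comp (continuous_measurable_fun (@continuous_cos R))).
  by apply: measurable_funB.
have ReI (F : R -> R[i]) : Re (cintegral F) = rint (fun x => Re (F x)) by [].
have ImI (F : R -> R[i]) : Im (cintegral F) = rint (fun x => Im (F x)) by [].
apply: complex_ext; rewrite ?ReI ?ImI.
  transitivity (rint (fun x => u_airy alpha x t * costr 0 (fun x => Re (phi x)) x -
      u_airy alpha x t * costr (- (pi / 2)) (fun x => Im (phi x)) x)).
    by apply: rint_ext => x; rewrite Re_mulc fourierE //= mul0r subr0 mulrBr.
  rewrite rintB; [|exact: L..].
  rewrite !u_airy_pairing // -rintB; [|exact: M..].
  by apply: rint_ext => s; rewrite Re_mulc /= subr0 opprK cosDpihalf cosN sinN; ring.
transitivity (rint (fun x => u_airy alpha x t * costr 0 (fun x => Im (phi x)) x +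
    u_airy alpha x t * costr (- (pi / 2)) (fun x => Re (phi x)) x)).
  by apply: rint_ext => x; rewrite Im_mulc fourierE //= mul0r addr0 mulrDr.
rewrite rintD; [|exact: L..].
rewrite !u_airy_pairing // -rintD; [|exact: M..].
by apply: rint_ext => s; rewrite Im_mulc /= subr0 opprK cosDpihalf cosN sinN; ring.
Qed.

Lemma u_airy_tempered t : 0 < t ->
  tempered (fun psi => cintegral (fun x => (u_airy alpha x t)%:C * psi x)).
Proof.
move=> t0; split=> [z phi psi sphi spsi|].
  rewrite -cintegrable_lin; try exact: u_airy_mul_integrable.
  by congr cintegral; apply/funext => x; ring.
have [C [k [C0 hC]]] := u_airy_bound alpha1 t0.
(* Only the orders [(0, 0)] and [(k + 2, 0)] enter. Each component is at most [2 D S] times the mass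
   [pi] of the majorant, and there are two components. *)
pose D := C * 2 ^+ k.+2; exists k.+2, (2 * pi * (2 * D)) => phi sphi.
set S := \sum_(m < _) _.
have /schwartzP[s1 s2] := sphi.
have D0 : 0 <= D by rewrite mulr_ge0 // exprn_ge0.
have B f : (forall x, `|f x| <= cmod (phi x)) -> rschwartz f ->
    `|rint (fun x => u_airy alpha x t * f x)| <= pi * (2 * D) * S.
  move=> fphi sf; have [lo intp] := @L1_oneDsqrV R.
  have b0 x : `|f x| <= S.
    apply: le_trans (seminorm_le_sum sphi (leq0n k.+2) (leq0n k.+2)).
    apply: le_trans (seminorm_ub 0 0 x sphi); rewrite expr0 mul1r.
    by rewrite cderive1n0; exact: fphi.
  have b1 x : `|x| ^+ k.+2 * `|f x| <= S.
    apply: le_trans (seminorm_le_sum sphi (leqnn k.+2) (leq0n k.+2)).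
    apply: le_trans (seminorm_ub k.+2 0 x sphi); rewrite ler_wpM2l ?exprn_ge0 //.
    by rewrite cderive1n0; exact: fphi.
  have bd x : `|u_airy alpha x t * f x| <= D * (S + S) * (1 + x ^+ 2)^-1.
    apply: le_trans (poly_growth_bound C0 (b0 x) (b1 x)).
    by rewrite normrM ler_wpM2r //; case: (hC x).
  have lf : L1 (fun x => u_airy alpha x t * f x).
    apply: (L1_le _ (L1Z (D * (S + S)) lo) bd).
    apply: measurable_funM; first exact: u_airy_measurable.
    exact: rschwartz_measurable.
  apply: le_trans (le_norm_rint lf (L1Z (D * (S + S)) lo) bd) _.
  by rewrite rintZ // intp le_eqVlt; apply/orP; left; apply/eqP; ring.
apply: le_trans (cmod_le _) _ => /=.
have E1 : rint (fun x => Re ((u_airy alpha x t)%:C * phi x)) =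
    rint (fun x => u_airy alpha x t * Re (phi x)).
  by apply: rint_ext => x; rewrite Re_mulc /= mul0r subr0.
have E2 : rint (fun x => Im ((u_airy alpha x t)%:C * phi x)) =
    rint (fun x => u_airy alpha x t * Im (phi x)).
  by apply: rint_ext => x; rewrite Im_mulc /= mul0r addr0.
rewrite E1 E2.
have := lerD (B _ (fun x => cmod_Re (phi x)) s1) (B _ (fun x => cmod_Im (phi x)) s2).
lra.
Qed.

Lemma dirac_tempered : tempered (@dirac_distr R).
Proof.
split=> [//|]; exists 0%N, 1 => phi sphi.
rewrite mul1r; apply: le_trans (seminorm_le_sum sphi (leq0n 0) (leq0n 0)).
apply: le_trans (seminorm_ub 0 0 0 sphi); rewrite expr0 mul1r.
by rewrite cderive1n0.
Qed.

Lemma expi0 : expi 0 = 1 :> R[i].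
Proof. by rewrite /expi cos0 sin0. Qed.

(** Keeps the uniqueness statement from being vacuous. The Dirac distribution is put in by hand at
    [t = 0], where the Airy formula degenerates; the transform [exp (- i odd_phase)] is one formula
    for all [t >= 0]. *)
Lemma solution_exists : exists u : R -> distr R, riesz_feller_cauchy_solution alpha 1 u.
Proof.
exists (fun t => if t == 0 then @dirac_distr R
  else fun psi => cintegral (fun x => (u_airy alpha x t)%:C * psi x)).
split=> [t t0|].
  case: eqP => [_|/eqP tn0]; first exact: dirac_tempered.
  by apply: u_airy_tempered; rewrite lt_neqAle eq_sym tn0.
split; first by rewrite eqxx.
exists (fun y t => expi (- odd_phase alpha t y)); split=> [t t0 phi sphi|].
  split; first exact: expi_mul_integrable.
  rewrite /dfourier; case: eqP => [->|/eqP tn0].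
    (* The Dirac distribution evaluates [fourier phi] at 0, which is the integral of [phi], and the
       multiplier is 1 at time 0. *)
    rewrite /dirac_distr /fourier; congr cintegral; apply/funext => x.
    by rewrite odd_phaseE mulr0 mul0r oppr0.
  by apply: u_airy_fourier => //; rewrite lt_neqAle eq_sym tn0.
split=> [y t t0|].
  rewrite riesz_feller_hatE.
  have dw : is_derive t (1 : R) (fun t => - odd_phase alpha t y) (- freq y).
    apply: (@der_ext _ (fun t => (- freq y) * t + 0)); last exact: der_affine.
    by move=> s; rewrite odd_phaseE addr0 mulNr.
  split=> /=.
    by apply: is_derive_eq (der_cos dw) _; ring.
  by apply: is_derive_eq (der_sin dw) _; ring.
split=> y; first by rewrite odd_phaseE mulr0 oppr0 expi0.
have c0 : - odd_phase alpha t y @[t --> 0^'+] --> (0 : R).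
  rewrite -[X in _ --> X]oppr0 -[X in _ --> - X](mul0r (freq y)).
  apply: cvg_at_right_filter; apply: cvgN.
  by apply: cvgM; [exact: cvg_id|exact: cvg_cst].
have cc : `|cos (- odd_phase alpha t y) - 1| + `|sin (- odd_phase alpha t y)|
    @[t --> 0^'+] --> (0 : R).
  have c1 : cos (- odd_phase alpha t y) - 1 @[t --> 0^'+] --> (0 : R).
    rewrite -[X in _ --> X](subrr 1) -[X in _ --> X - _](@cos0 R).
    apply: cvgB; last exact: cvg_cst.
    exact: (@cvg_comp _ _ _ _ cos _ _ _ c0 (@continuous_cos R 0)).
  have s1 : sin (- odd_phase alpha t y) @[t --> 0^'+] --> (0 : R).
    rewrite -[X in _ --> X](@sin0 R).
    exact: (@cvg_comp _ _ _ _ sin _ _ _ c0 (@continuous_sin R 0)).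
  rewrite -[X in _ --> X]addr0 -[X in _ --> X + _](@normr0 _ R) -[X in _ --> _ + X](@normr0 _ R).
  by apply: cvgD; apply: cvg_norm.
apply: (squeeze_cvgr _ (cvg_cst 0) cc); near=> s.
rewrite cmod_ge0 andTb; apply: le_trans (cmod_le _) _.
by rewrite [odd_phase alpha 0 y]odd_phaseE mulr0 oppr0 expi0 /= subr0.
Unshelve. all: by end_near. Qed.

End cauchy_problem.

Theorem mainTheorem7 (R : realType) (alpha : R) (halpha : 1 < alpha) :
  (forall x : R, cvg (airy_partial alpha x A @[A --> +oo])) /\
  (exists u : R -> distr R, riesz_feller_cauchy_solution alpha 1 u) /\
  (forall u : R -> distr R, riesz_feller_cauchy_solution alpha 1 u ->
     forall t : R, 0 < t ->
       represents (u t) (fun x => (u_airy alpha x t)%:C)).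
Proof.
have alpha0 : 0 < alpha by exact: lt_trans halpha.
split=> [x|].
  have -> : airy_partial alpha x = osc alpha alpha^-1 x.
    by apply/funext => A; rewrite airy_partialE.
  by apply: osc_cvg => //; rewrite invr_gt0.
split; first exact: solution_exists.
move=> u [_ [_ [uhat [urep [uder [u0 uc]]]]]] t t0 psi spsi.
split; first exact: u_airy_mul_integrable.
(* Writing the test function as a transform brings it within reach of [urep]; both sides then become
   integrals against [phi], and the multipliers agree by uniqueness. *)
have [phi sphi <-] := fourier_surjective spsi.
rewrite u_airy_fourier //; have [_] := urep t (ltW t0) phi sphi.
rewrite /dfourier => ->; congr cintegral; apply/funext => y; congr (_ * _).
apply: uhat_unique => // s s0.
by have := uder y s s0; rewrite riesz_feller_hatE.
Qed.
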